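(* Let $G$ be a Lie group acting by biholomorphisms on a complex manifold $M$. The group $\mathrm{Pic}_G(M)$ of $G$-equivariant line bundles is isomorphic to $\mathrm H^1(G,\mathcal O^\times)$.
   Context: $\mathcal O^\times$ is the multiplicative sheaf of nonvanishing holomorphic functions on $M$. A lift of the action $\rho\colon G\times M\to M$ to a holomorphic line bundle $\pi\colon L\to M$ is an action $\hat\rho\colon G\times L\to L$ such that each $\hat\rho_g\colon L\to L$ is a (holomorphic) vector bundle automorphism and $\pi\circ\hat\rho=\rho\circ(\mathrm{id}\times\pi)$. The pair $(\pi,\hat\rho)$ is a $G$-equivariant line bundle; $\mathrm{Pic}_G(M)$ is the group (under tensor product) of $G$-equivariant line bundles modulo the natural equivalences. Elements of $G$ are written $\varphi,\psi$, and also denote the corresponding biholomorphisms of $M$. For an open cover $\mathcal U=\{U_\alpha\}$ of $M$: 0-cochains are $\mu=\{\mu_\alpha\in\mathcal O^\times(U_\alpha)\}$; 1-cochains are $\Lambda=\{\Lambda_{\alpha\beta}\}$ assigning to each $\varphi\in G$ functions $\Lambda_{\alpha\beta}(\varphi)\in\mathcal O^\times(U_\beta\cap\varphi^{-1}(U_\alpha))$ (cochains are taken holomorphic, in the spirit of continuous rather than abstract group cohomology). The differentials are $$(D^0\mu(\varphi))_{\alpha\beta}=\frac{\varphi^*(\mu_\alpha)}{\mu_\beta},\qquad (D^1\Lambda(\varphi,\psi))_{\alpha\beta\gamma}=\frac{\Lambda_{\alpha\gamma}(\varphi\circ\psi)}{\psi^*(\Lambda_{\alpha\beta}(\varphi))\,\Lambda_{\beta\gamma}(\psi)}$$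 (the latter on $U_\gamma\cap\psi^{-1}(U_\beta)\cap\psi^{-1}(\varphi^{-1}(U_\alpha))$). Put $\mathrm H^1_{\mathcal U}(G,\mathcal O^\times)=\ker(D^1)/\mathrm{im}(D^0)$ and $\mathrm H^1(G,\mathcal O^\times)=\varinjlim_{\mathcal U}\mathrm H^1_{\mathcal U}(G,\mathcal O^\times)$, the direct limit over refinements of covers. *)

(* Defs.v *)
From HB Require Import structures.
From mathcomp Require Import all_boot all_order all_algebra.
From mathcomp Require Import complex.
From mathcomp Require Import all_classical all_reals all_analysis.

Set Implicit Arguments.
Unset Strict Implicit.
Unset Printing Implicit Defensive.

Import Order.TTheory GRing.Theory Num.Theory.
Import numFieldNormedType.Exports.

Local Open Scope classical_set_scope.
Local Open Scope complex_scope.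
Local Open Scope ring_scope.

(* Throughout, a map on an open set [D] is represented by a total function
   whose values outside [D] are irrelevant: all conditions are imposed at the
   points of [D] only. *)

Definition Cfield (R : realType) : numFieldType := R[i].

Fixpoint Ck_on (R : realType) (k m n : nat) (D : set 'rV[R]_m)
    (f : 'rV[R]_m -> 'rV[R]_n) : Prop :=
  if k is k'.+1 then
    (forall x, D x -> differentiable f x) /\
    (forall v, Ck_on k' D (fun x => 'D_v f x))
  else forall x, D x -> {for x, continuous f}.

Definition smooth_on (R : realType) (m n : nat) (D : set 'rV[R]_m)
    (f : 'rV[R]_m -> 'rV[R]_n) : Prop := forall k, Ck_on k D f.

Definition realify (R : realType) (n : nat) (v : 'rV[Cfield R]_n) :
    'rV[R]_(n + n) :=
  row_mx (map_mx (@complex.Re R) v) (map_mx (@complex.Im R) v).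

Definition complexify (R : realType) (n : nat) (v : 'rV[R]_(n + n)) :
    'rV[Cfield R]_n :=
  \row_j (lsubmx v 0 j +i* rsubmx v 0 j).

(* As in Griffiths-Harris: C^oo in the real sense, with a C-linear differential
   (the Cauchy-Riemann equations) at every point. *)
Definition holomorphic_on (R : realType) (m n : nat) (D : set 'rV[Cfield R]_m)
    (f : 'rV[Cfield R]_m -> 'rV[Cfield R]_n) : Prop :=
  smooth_on (@realify R m @` D) (@realify R n \o f \o @complexify R m) /\
  (forall x, D x -> differentiable f x).

Record chart (K : numFieldType) (n : nat) (T : topologicalType) := Chart {
  cdom : set T;
  cfun : T -> 'rV[K]_n;
  cinv : 'rV[K]_n -> T }.

Definition is_chart (K : numFieldType) (n : nat) (T : topologicalType)
    (c : chart K n T) : Prop :=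
  [/\ open (cdom c),
      open (cfun c @` cdom c),
      forall x, cdom c x -> cinv c (cfun c x) = x,
      forall x, cdom c x -> {for x, continuous (cfun c)} &
      forall y, (cfun c @` cdom c) y -> {for y, continuous (cinv c)}].

Record charted (K : numFieldType) (n : nat) := Charted {
  cpt :> topologicalType;
  atlas : set (chart K n cpt) }.
Arguments atlas {K n} _.

Definition regularity (K : numFieldType) :=
  forall m n : nat, set 'rV[K]_m -> ('rV[K]_m -> 'rV[K]_n) -> Prop.

Definition is_manifold (K : numFieldType) (reg : regularity K) (n : nat)
    (X : charted K n) : Prop :=
  [/\ hausdorff_space X,
      @second_countable X,
      forall c, atlas X c -> is_chart c,
      forall x : X, exists2 c, atlas X c & cdom c x &
      forall c d, atlas X c -> atlas X d ->
        reg _ _ (cfun c @` (cdom c `&` cdom d)) (cfun d \o cinv c)].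

Definition regular_on (K : numFieldType) (reg : regularity K) (m n : nat)
    (X : charted K m) (Y : charted K n) (D : set X) (f : X -> Y) : Prop :=
  (forall x, D x -> {for x, continuous f}) /\
  (forall c d, atlas X c -> atlas Y d ->
     reg _ _ (cfun c @` (D `&` cdom c `&` f @^-1` cdom d))
             (cfun d \o f \o cinv c)).

Definition prod_chart (K : numFieldType) (m n : nat) (S T : topologicalType)
    (c : chart K m S) (d : chart K n T) : chart K (m + n) (S * T)%type :=
  Chart (cdom c `*` cdom d)
        (fun p => row_mx (cfun c p.1) (cfun d p.2))
        (fun w => (cinv c (lsubmx w), cinv d (rsubmx w))).

Definition prod_charted (K : numFieldType) (m n : nat)
    (X : charted K m) (Y : charted K n) : charted K (m + n) :=
  @Charted K (m + n) (X * Y)%type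
    [set prod_chart c d | c in atlas X & d in atlas Y].

Definition line_charted (K : numFieldType) : charted K 1 :=
  @Charted K 1 K [set Chart setT (fun z => const_mx z) (fun w => w 0 0)].

Record complexManifold (R : realType) (n : nat) := ComplexManifold {
  cm_charted :> charted (Cfield R) n;
  cm_manifold : is_manifold (@holomorphic_on R) cm_charted }.

Definition holo (R : realType) (m n : nat) (X : charted (Cfield R) m)
    (Y : charted (Cfield R) n) (D : set X) (f : X -> Y) : Prop :=
  regular_on (@holomorphic_on R) D f.

(* A Lie group is either real or complex. Maps involving a real (resp. complex)
   Lie group are required to be smooth (resp. holomorphic); for this purpose a
   complex manifold is regarded as a real manifold of twice the dimension
   (resp. as itself). *)
Variant lie_kind := RealLie | ComplexLie.

Definition lie_field (R : realType) (k : lie_kind) : numFieldType :=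
  if k is RealLie then (R : numFieldType) else Cfield R.

Definition lie_reg (R : realType) (k : lie_kind) : regularity (lie_field R k) :=
  match k with
  | RealLie => @smooth_on R
  | ComplexLie => @holomorphic_on R
  end.

Definition lie_dim (k : lie_kind) (n : nat) : nat :=
  if k is RealLie then (n + n)%N else n.

Definition underlying_chart (R : realType) (k : lie_kind) (n : nat)
    (T : topologicalType) :
    chart (Cfield R) n T -> chart (lie_field R k) (lie_dim k n) T :=
  match k with
  | RealLie => fun c =>
      @Chart R (n + n) T (cdom c) (@realify R n \o cfun c)
             (cinv c \o @complexify R n)
  | ComplexLie => fun c => c
  end.

Definition underlying (R : realType) (k : lie_kind) (n : nat)
    (X : charted (Cfield R) n) : charted (lie_field R k) (lie_dim k n) :=
  Charted (@underlying_chart R k n X @` atlas X).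

HB.structure Definition GroupTopological := {T of Group T & Topological T}.

Record lieGroup (R : realType) (k : lie_kind) (m : nat) := LieGroup {
  lg_sort :> GroupTopological.type;
  lg_atlas : set (chart (lie_field R k) m lg_sort);
  lg_charted := Charted lg_atlas;
  lg_manifold : is_manifold (@lie_reg R k) lg_charted;
  lg_mul : regular_on (X := prod_charted lg_charted lg_charted)
    (Y := lg_charted) (@lie_reg R k) setT (fun p => (p.1 * p.2)%g);
  lg_inv : regular_on (X := lg_charted) (Y := lg_charted)
    (@lie_reg R k) setT (fun g => g^-1%g) }.

Section Equivariant.
Variables (R : realType) (k : lie_kind) (m n : nat).
Variables (G : lieGroup R k m) (M : complexManifold R n).
Local Notation C := (Cfield R).
Local Notation C1 := (line_charted (Cfield R)).

(* [f : G * X -> Y] is smooth if [G] is a real Lie group, and holomorphic if [G]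
   is a complex Lie group. *)
Definition jointly_regular (p q : nat) (X : charted C p) (Y : charted C q)
    (D : set (G * X)%type) (f : G * X -> Y) : Prop :=
  regular_on (X := prod_charted (lg_charted G) (underlying k X))
    (Y := underlying k Y) (@lie_reg R k) D f.

Record action := Action {
  act :> G -> M -> M;
  act1 : forall x, act 1%g x = x;
  actM : forall g h x, act (g * h)%g x = act g (act h x);
  act_regular : jointly_regular setT (fun p : G * M => act p.1 p.2 : M);
  act_holo : forall g, holo setT (act g) }.

(* [lb_incl x] identifies the one-dimensional vector space [lb_fiber x] with the
   fibre of [lb_proj] over [x]. *)
Record lineBundle := LineBundle {
  lb_total :> complexManifold R (n + 1);
  lb_proj : lb_total -> M;
  lb_proj_holo : holo setT lb_proj;
  lb_fiber : M -> vectType C;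
  lb_rank : forall x, \dim {: lb_fiber x} = 1%N;
  lb_incl : forall x, lb_fiber x -> lb_total;
  lb_incl_inj : forall x, injective (@lb_incl x);
  lb_incl_range : forall x, range (@lb_incl x) = lb_proj @^-1` [set x];
  lb_trivial : forall x : M, exists (U : set M)
      (t : lb_total -> M * C) (s : M * C -> lb_total),
    [/\ open U /\ U x,
        holo (Y := prod_charted M C1) (lb_proj @^-1` U) t /\
          holo (X := prod_charted M C1) (U `*` setT) s,
        forall e, U (lb_proj e) -> (t e).1 = lb_proj e /\ s (t e) = e,
        forall p, U p.1 -> lb_proj (s p) = p.1 /\ t (s p) = p &
        forall y, U y ->
          linear (fun u : lb_fiber y => (t (lb_incl u)).2 : C^o)] }.

Definition fiberwise_linear (E F : lineBundle) (h : M -> M) (f : E -> F) :=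
  forall x, exists A : {linear lb_fiber E x -> lb_fiber F (h x)},
    forall u, f (lb_incl u) = lb_incl (A u).

(* Each [lift g] is then a vector bundle automorphism covering [rho g]: its
   inverse is [lift g^-1]. *)
Record equivariantLineBundle (rho : action) := EquivariantLineBundle {
  elb_bundle :> lineBundle;
  lift : G -> elb_bundle -> elb_bundle;
  lift1 : forall e, lift 1%g e = e;
  liftM : forall g h e, lift (g * h)%g e = lift g (lift h e);
  lift_regular :
    jointly_regular setT (fun p : G * elb_bundle => lift p.1 p.2 : elb_bundle);
  lift_holo : forall g, holo setT (lift g);
  lift_proj : forall g e, lb_proj (lift g e) = rho g (lb_proj e);
  lift_linear : forall g, fiberwise_linear (rho g) (lift g) }.

Definition elb_equiv (rho : action) (E F : equivariantLineBundle rho) : Prop :=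
  exists (f : E -> F) (f' : F -> E),
    [/\ cancel f f' /\ cancel f' f,
        holo setT f /\ holo setT f',
        fiberwise_linear id f &
        forall g e, f (lift g e) = lift g (f e)].

Definition is_bilinear (U V W : lmodType C) (b : U -> V -> W) : Prop :=
  (forall u, linear (b u)) /\ (forall v, linear (b^~ v)).

(* The universal property of the tensor product of vector spaces. *)
Definition is_tensor_map (U V W : lmodType C) (b : U -> V -> W) : Prop :=
  is_bilinear b /\
  forall (Z : lmodType C) (c : U -> V -> Z), is_bilinear c ->
    exists h : {linear W -> Z}, (forall u v, h (b u v) = c u v) /\
      forall h' : {linear W -> Z}, (forall u v, h' (b u v) = c u v) -> h' =1 h.

(* [L] is the tensor product of [E] and [F]: each fibre of [L] is the tensor
   product of the fibres of [E] and [F], the product of holomorphic local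
   sections is holomorphic, and [G] acts diagonally. *)
Definition is_tensor (rho : action) (E F L : equivariantLineBundle rho) : Prop :=
  exists b : forall x, lb_fiber E x -> lb_fiber F x -> lb_fiber L x,
    [/\ forall x, is_tensor_map (@b x),
        forall (U : set M) (s : forall x, lb_fiber E x)
            (t : forall x, lb_fiber F x), open U ->
          holo (X := M) (Y := E) U (fun x => lb_incl (s x)) ->
          holo (X := M) (Y := F) U (fun x => lb_incl (t x)) ->
          holo (X := M) (Y := L) U (fun x => lb_incl (b x (s x) (t x))) &
        forall g x (u : lb_fiber E x) (v : lb_fiber F x)
            (u' : lb_fiber E (rho g x)) (v' : lb_fiber F (rho g x)),
          lift g (lb_incl u) = lb_incl u' ->
          lift g (lb_incl v) = lb_incl v' ->
          lift g (lb_incl (b x u v)) = lb_incl (b (rho g x) u' v')].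

Record openCover := OpenCover {
  oc_index : Type;
  oc_set :> oc_index -> set M;
  oc_open : forall i, open (oc_set i);
  oc_cover : forall x, exists i, oc_set i x }.

Definition cochain0 (U : openCover) := oc_index U -> M -> C.
Definition cochain1 (U : openCover) := oc_index U -> oc_index U -> G -> M -> C.

Definition is_cochain0 (U : openCover) (mu : cochain0 U) : Prop :=
  forall a, holo (X := M) (Y := C1) (U a) (mu a) /\
    (forall x, U a x -> mu a x != 0).

Definition is_cochain1 (rho : action) (U : openCover) (L : cochain1 U) : Prop :=
  forall a b,
    [/\ jointly_regular (X := M) (Y := C1)
          [set p | U b p.2 /\ U a (rho p.1 p.2)] (fun p => L a b p.1 p.2),
        forall g, holo (X := M) (Y := C1)
          (U b `&` rho g @^-1` U a) (L a b g) &
        forall g x, U b x -> U a (rho g x) -> L a b g x != 0].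

Definition D0 (rho : action) (U : openCover) (mu : cochain0 U) : cochain1 U :=
  fun a b g x => mu a (rho g x) / mu b x.

Definition D1 (rho : action) (U : openCover) (L : cochain1 U)
    (a b c : oc_index U) (g h : G) (x : M) : C :=
  L a c (g * h)%g x / (L a b g (rho h x) * L b c h x).

Definition is_cocycle (rho : action) (U : openCover) (L : cochain1 U) : Prop :=
  is_cochain1 rho L /\
  forall a b c g h x, U c x -> U b (rho h x) -> U a (rho g (rho h x)) ->
    D1 rho L a b c g h x = 1.

(* [L'] and [L] differ by an element of im(D0). *)
Definition cohomologous (rho : action) (U : openCover) (L L' : cochain1 U) :
    Prop :=
  exists2 mu : cochain0 U, is_cochain0 mu &
    forall a b g x, U b x -> U a (rho g x) ->
      L' a b g x / L a b g x = D0 rho mu a b g x.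

Definition refines (V U : openCover) (r : oc_index V -> oc_index U) : Prop :=
  forall i, V i `<=` U (r i).

Definition pullback (V U : openCover) (r : oc_index V -> oc_index U)
    (L : cochain1 U) : cochain1 V := fun a b => L (r a) (r b).

Record cocycle (rho : action) := Cocycle {
  coc_cover : openCover;
  coc_fun : cochain1 coc_cover;
  coc_cocycle : is_cocycle rho coc_fun }.

(* Elements of the direct limit of the groups ker(D1) / im(D0) over refinements
   of covers are represented by cocycles on arbitrary covers; two of them
   represent the same element when they become cohomologous on a common
   refinement, and products are computed on a common refinement. *)
Definition coc_equiv (rho : action) (L L' : cocycle rho) : Prop :=
  exists (V : openCover) (r : oc_index V -> oc_index (coc_cover L))
      (r' : oc_index V -> oc_index (coc_cover L')),
    [/\ refines r, refines r' &
        cohomologous rho (pullback r (@coc_fun _ L))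
                         (pullback r' (@coc_fun _ L'))].

Definition is_coc_product (rho : action) (L L' L'' : cocycle rho) : Prop :=
  exists (V : openCover) (r : oc_index V -> oc_index (coc_cover L))
      (r' : oc_index V -> oc_index (coc_cover L'))
      (r'' : oc_index V -> oc_index (coc_cover L'')),
    [/\ refines r, refines r', refines r'' &
        cohomologous rho
          (fun a b g x => pullback r (@coc_fun _ L) a b g x *
                          pullback r' (@coc_fun _ L') a b g x)
          (pullback r'' (@coc_fun _ L''))].

End Equivariant.

(* The abelian group of equivalence classes of elements of [T], where [mul x y z]
   means that [z] represents the product of the classes of [x] and [y]. It is
   written additively, and determined up to unique isomorphism. *)
Record classGroup (T : Type) (equiv : T -> T -> Prop) (mul : T -> T -> T -> Prop)
    := ClassGroup {
  cg_group :> zmodType;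
  cg_class : T -> cg_group;
  cg_surj : forall a, exists x, cg_class x = a;
  cg_equiv : forall x y, cg_class x = cg_class y <-> equiv x y;
  cg_mul : forall x y z, cg_class z = cg_class x + cg_class y <-> mul x y z }.

Definition picardGroup (R : realType) (k : lie_kind) (m n : nat)
    (G : lieGroup R k m) (M : complexManifold R n) (rho : action G M) :=
  classGroup (@elb_equiv R k m n G M rho) (@is_tensor R k m n G M rho).

Definition H1Group (R : realType) (k : lie_kind) (m n : nat)
    (G : lieGroup R k m) (M : complexManifold R n) (rho : action G M) :=
  classGroup (@coc_equiv R k m n G M rho) (@is_coc_product R k m n G M rho).

(* Main.v *)
From HB Require Import structures.
Require Import Defs.
From mathcomp Require Import all_boot all_order all_algebra.
From mathcomp Require Import complex ring lra.
From mathcomp Require Import all_classical all_reals all_analysis.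

Set Implicit Arguments.
Unset Strict Implicit.
Unset Printing Implicit Defensive.

Import Order.TTheory GRing.Theory Num.Theory.
Import numFieldNormedType.Exports.

Local Open Scope classical_set_scope.
Local Open Scope complex_scope.
Local Open Scope ring_scope.

(** Over a small open set an equivariant line bundle has a frame, a nonvanishing
holomorphic section, and the lifted action sends the frame of index [b] at [x] to
a multiple, by a scalar [L a b g x], of the frame of index [a] at [g x]. These
scalars form a 1-cocycle for the differential [D1]: the cocycle identity says that
the lift is an action, and for [g = 1] it says that [L a b 1] are the transition
functions of the bundle ([lift_cocycle_is_cocycle]). Over a fixed cover, the
dictionary is the following.

- An equivariant isomorphism multiplies frames by a 0-cochain, so that bundles are
isomorphic exactly when their cocycles are cohomologous ([equiv_cohomologous]). To
rebuild an isomorphism from a 0-cochain, the local maps that it defines have to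
agree on intersections, which is the cohomology relation for [g = 1].

- The products of the frames of two bundles frame their tensor product, on which
[G] acts by the product of the cocycles ([tensor_cohomologous],
[cohomologous_tensor]).

- Each cocycle comes from a bundle, obtained by gluing the products of the members
of the cover with the complex line along the functions [L a b 1]; the action is
given in trivialisations by [L a b g] ([cocycle_bundle_framing]).

Since framings and cocycles can be restricted to common refinements, the choice of a
cocycle for each bundle identifies isomorphism with equivalence of cocycles and
tensor products with products of cocycles. Classes of cocycles form a group by
pointwise multiplication ([H1Group_exists]), where transitivity of the equivalence
uses that two refinement maps restrict a cocycle to cohomologous ones
([pullback_cohomologous]). Classes of bundles are then the same group, and the group
axioms for the tensor product need no separate proof.

Regularity is dealt with uniformly for real and complex Lie groups: smooth maps and
holomorphic maps share the properties listed in [is_regularity], from which the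
calculus of regular maps between charted spaces follows; holomorphic maps become
smooth maps of the underlying real manifolds ([underlying_regular_at]). All the maps
above are then regular as composites of actions, trivialisations, and the
multiplication and inversion of complex numbers. *)

(** * Germs and coordinates of maps *)

Lemma near_open (T : topologicalType) (D : set T) x (P : T -> Prop) :
  open D -> D x -> (forall y, D y -> P y) -> \forall y \near x, P y.
Proof. by move=> oD Dx DP; apply: filterS DP _; exact: open_nbhs_nbhs. Qed.

(** The difference of the two maps vanishes near [x], so that its differential
at [x] is zero. *)
Lemma differentiable_near_eq (K : numFieldType) (V W : normedModType K)
    (f g : V -> W) x :
  (\forall y \near x, f y = g y) -> differentiable f x -> differentiable g x.
Proof.
move=> fg df; pose z : V -> W := g - f.
have -> : g = f + z by rewrite /z addrC subrK.
apply: differentiableD => //.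
have zx : z \o shift x = cst (z x) + 0 +o_ (0 : V) id.
  apply/eqaddoP => e e0.
  move: fg; rewrite (near_shift 0) => fg.
  have z0 : z x = 0.
    by move: (nbhs_singleton fg); rewrite /= add0r subr0 /z !fctE => ->; rewrite subrr.
  near=> h; rewrite !fctE z0 addr0 subr0 /z !fctE /=.
  have -> : f (h + x) = g (h + x).
    have : (fun y => f y = g y) (shift (x - 0) h) by near: h.
    by rewrite /= subr0.
  by rewrite subrr normr0 mulr_ge0// ltW.
have c0 : continuous (0 : V -> W) by move=> ?; exact: cvg_cst.
have dz : 'd z x = 0 :> (V -> W) by exact/diff_unique.
by apply/diff_locallyP; rewrite dz.
Unshelve. all: by end_near. Qed.

Lemma continuous_near_eq (S T : topologicalType) (f g : S -> T) x :
  (\forall y \near x, f y = g y) ->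
  {for x, continuous f} -> {for x, continuous g}.
Proof.
move=> fg fx; rewrite /prop_for /continuous_at -(nbhs_singleton fg).
apply: cvg_trans fx; exact: near_eq_cvg.
Qed.

Lemma continuous_coordinate (K : numFieldType) (T : topologicalType) m p
    (f : T -> 'M[K]_(m, p)) x :
  {for x, continuous f} <->
  forall i j, {for x, continuous (fun y => f y i j)}.
Proof.
split=> [cf i j|cf].
  exact: (continuous_comp cf (@coord_continuous _ _ _ i j _)).
move=> A [P PA /filterS]; apply.
have : \forall y \near x, forall ij, P ij.1 ij.2 (f y ij.1 ij.2).
  by apply: filter_forall => -[i j]; exact/cf/PA.
by apply: filterS => y Py i j; exact: (Py (i, j)).
Qed.

Lemma differentiable_coordinate (K : numFieldType) (V : normedModType K) p
    (f : V -> 'rV[K]_p) x :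
  differentiable f x <-> forall j, differentiable (fun y => f y 0 j) x.
Proof.
split=> [df j|df].
  exact: (differentiable_comp df (differentiable_coord _ _ _)).
have -> : f = fun y => \sum_j f y 0 j *: delta_mx 0 j.
  by apply/funext => y; exact: row_sum_delta.
have -> : (fun y => \sum_j f y 0 j *: delta_mx 0 j) =
   \sum_j (fun y => f y 0 j *: (delta_mx 0 j : 'rV[K]_p)).
  by apply/funext => y; rewrite fct_sumE.
apply: differentiable_sum => j.
exact: differentiableZl.
Qed.

Lemma differentiable_row (K : numFieldType) (V : normedModType K) m n
    (f : V -> 'rV[K]_m) (g : V -> 'rV[K]_n) x :
  differentiable f x -> differentiable g x ->
  differentiable (fun y => row_mx (f y) (g y)) x.
Proof.
move=> /differentiable_coordinate df /differentiable_coordinate dg.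
apply/differentiable_coordinate => j; case: (splitP j) => i ji.
  have -> : j = lshift n i by exact/val_inj.
  suff -> : (fun y => row_mx (f y) (g y) 0 (lshift n i)) = fun y => f y 0 i by [].
  by apply/funext => y; rewrite row_mxEl.
have -> : j = rshift m i by exact/val_inj.
suff -> : (fun y => row_mx (f y) (g y) 0 (rshift m i)) = fun y => g y 0 i by [].
by apply/funext => y; rewrite row_mxEr.
Qed.

(** * Functions of class C^k *)

Section CkCalculus.
Variable R : realType.

(** [Ck_on] for scalar functions, which can be multiplied and inverted; a map is
of class C^k as soon as its coordinates are, see [CkP]. *)
Fixpoint ck (k m : nat) (D : set 'rV[R]_m) (h : 'rV[R]_m -> R) : Prop :=
  if k is k'.+1 then
    (forall x, D x -> differentiable h x) /\
    (forall v, ck k' D (fun x => 'D_v h x))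
  else forall x, D x -> {for x, continuous h}.

(** On an open set, functions with the same values have the same derivatives. *)
Lemma ck_congr k m (D : set 'rV[R]_m) h h' : open D ->
  (forall x, D x -> h x = h' x) -> ck k D h -> ck k D h'.
Proof.
move=> oD; elim: k h h' => [|k IH] h h' hh' /=.
  by move=> ch x Dx; apply: continuous_near_eq (ch x Dx); exact: near_open hh'.
move=> [dh ch]; split=> [x Dx|v].
  by apply: differentiable_near_eq (dh x Dx); exact: near_open hh'.
apply: IH (ch v) => x Dx; apply: near_eq_derive; exact: near_open hh'.
Qed.

Lemma ckS k m (D : set 'rV[R]_m) h : ck k.+1 D h -> ck k D h.
Proof.
elim: k h => [|k IH] h /= [dh ch]; first by move=> x /dh /differentiable_continuous.
by split=> // v; apply: IH; exact: ch.
Qed.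

Lemma ck_cst k m (D : set 'rV[R]_m) (a : R) : ck k D (fun=> a).
Proof.
elim: k a => [|k IH] a /=; first by move=> x _; exact: cst_continuous.
split=> [x _|v]; first exact: differentiable_cst.
have -> : (fun x : 'rV[R]_m => 'D_v (fun=> a) x) = fun=> 0.
  by apply/funext => x; rewrite derive_cst.
exact: IH.
Qed.

Lemma ckD k m (D : set 'rV[R]_m) f g : open D ->
  ck k D f -> ck k D g -> ck k D (fun x => f x + g x).
Proof.
move=> oD; elim: k f g => [|k IH] f g /=.
  by move=> cf cg x Dx; apply: continuousD; [exact: cf|exact: cg].
move=> [df cf] [dg cg]; split=> [x Dx|v].
  by apply: differentiableD; [exact: df|exact: dg].
apply: (ck_congr oD _ (IH _ _ (cf v) (cg v))) => x Dx.
by rewrite -deriveD//; apply: diff_derivable; [exact: df|exact: dg].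
Qed.

Lemma ck_sum k m p (D : set 'rV[R]_m) (f : 'I_p -> 'rV[R]_m -> R) : open D ->
  (forall i, ck k D (f i)) -> ck k D (fun x => \sum_i f i x).
Proof.
move=> oD cf; elim: p f cf => [|p IH] f cf.
  by apply: (ck_congr oD _ (ck_cst k D 0)) => x _; rewrite big_ord0.
apply: (ck_congr oD _ (ckD oD (cf ord0) (IH (f \o lift ord0) _))) => [x _|i].
  by rewrite big_ord_recl.
exact: cf.
Qed.

Lemma ckM k m (D : set 'rV[R]_m) f g : open D ->
  ck k D f -> ck k D g -> ck k D (fun x => f x * g x).
Proof.
move=> oD; elim: k f g => [|k IH] f g.
  by move=> cf cg x Dx; apply: continuousM; [exact: cf|exact: cg].
move=> cf cg; have cf' := ckS cf; have cg' := ckS cg.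
case: cf cg => [df cf] [dg cg]; split=> [x Dx|v].
  by apply: differentiableM; [exact: df|exact: dg].
apply: (ck_congr oD _ (ckD oD (IH _ _ cf' (cg v)) (IH _ _ cg' (cf v)))) => x Dx.
by rewrite deriveM//; apply: diff_derivable; [exact: df|exact: dg].
Qed.

Lemma ckN k m (D : set 'rV[R]_m) f : open D ->
  ck k D f -> ck k D (fun x => - f x).
Proof.
move=> oD cf; apply: (ck_congr oD _ (ckM oD (ck_cst k D (-1)) cf)) => x _.
by rewrite mulN1r.
Qed.

Lemma ckV k m (D : set 'rV[R]_m) f : open D -> (forall x, D x -> f x != 0) ->
  ck k D f -> ck k D (fun x => (f x)^-1).
Proof.
move=> oD f0; elim: k => [|k IH].
  by move=> cf x Dx; apply: continuousV; [exact: f0|exact: cf].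
move=> cf; have cf' := IH (ckS cf); case: cf => df cf; split=> [x Dx|v].
  by apply: differentiableV; [exact: df|exact: f0].
apply: (ck_congr oD _ (ckN oD (ckM oD (ckM oD cf' cf') (cf v)))) => x Dx.
rewrite deriveV//; [|exact: f0|exact/diff_derivable/df].
by rewrite -[RHS]/(_ * _) expr2 invfM mulNr.
Qed.

Lemma CkP k m p (D : set 'rV[R]_m) (f : 'rV[R]_m -> 'rV[R]_p) : open D ->
  Ck_on k D f <-> forall j, ck k D (fun y => f y 0 j).
Proof.
move=> oD; elim: k f => [|k IH] f /=.
  split=> [cf j x Dx|cf x Dx]; first by move/continuous_coordinate: (cf x Dx).
  by apply/continuous_coordinate => i j; rewrite (ord1 i); exact: cf.
have E v j : (forall x, D x -> differentiable f x) ->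
    forall x, D x -> 'D_v f x 0 j = 'D_v (fun y => f y 0 j) x.
  by move=> df x Dx; rewrite derive_mx ?mxE//; exact/diff_derivable/df.
split=> [[df cf] j|cf].
  split=> [x Dx|v]; first by move/differentiable_coordinate: (df _ Dx).
  by apply: (ck_congr oD (E v j df)); exact: (IH _).1.
have df x : D x -> differentiable f x.
  by move=> Dx; apply/differentiable_coordinate => j; case: (cf j) => + _; exact.
split=> // v; apply/IH => j; apply: (ck_congr oD _ ((cf j).2 v)) => x Dx.
by rewrite (E v j df).
Qed.

Lemma CkS k m p (D : set 'rV[R]_m) (f : 'rV[R]_m -> 'rV[R]_p) : open D ->
  Ck_on k.+1 D f -> Ck_on k D f.
Proof. by move=> oD /(CkP _ _ oD) cf; apply/(CkP _ _ oD) => j; exact/ckS/cf. Qed.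

(** The chain rule writes the derivative of [h \o f] along [v] as a sum, over the
coordinates [j], of products of a coordinate of ['D_v f] and of a partial
derivative of [h] composed with [f]; by induction on [k], each factor is of class
C^k when [f] and [h] are of class C^(k+1). *)
Lemma ck_comp k m p (D : set 'rV[R]_m) (D' : set 'rV[R]_p) f h :
  open D -> open D' -> (forall x, D x -> D' (f x)) ->
  Ck_on k D f -> ck k D' h -> ck k D (h \o f).
Proof.
move=> oD oD' DD'; elim: k h => [|k IH] h.
  by move=> cf ch x Dx; apply: continuous_comp; [exact: cf|exact/ch/DD'].
move=> cf ch; have cf' := CkS oD cf.
have df x : D x -> differentiable f x by case: cf => + _; exact.
have dh x : D' x -> differentiable h x by case: ch => + _; exact.
split=> [x Dx|v].
  by apply: differentiable_comp; [exact: df|exact/dh/DD'].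
have S : ck k D (fun x =>
    \sum_j ('D_v f x) 0 j * ((fun y => 'D_(delta_mx 0 j) h y) \o f) x).
  apply: ck_sum => // j; apply: ckM => //.
    by move: j; apply/(CkP k ('D_v f) oD); exact: cf.2.
  by apply: IH => //; exact: ch.2.
apply: (ck_congr oD _ S) => x Dx /=.
have dfx := df _ Dx; have dhx := dh _ (DD' _ Dx).
rewrite [RHS](deriveE v (differentiable_comp dfx dhx)).
rewrite diff_comp//= -(deriveE v dfx).
rewrite [in RHS](row_sum_delta ('D_v f x)) linear_sum/=.
by apply: eq_bigr => j _; rewrite linearZ/= (deriveE _ dhx).
Qed.

End CkCalculus.

(** * Smooth maps and holomorphic maps *)

(** What the theory of manifolds uses of a class of maps between open sets of
coordinate spaces. Smooth maps and holomorphic maps are both of this kind, so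
that real and complex Lie groups can be treated together. *)
Record is_regularity (K : numFieldType) (reg : regularity K) : Prop := {
  reg_pointwise : forall m n (D : set 'rV[K]_m) (f : 'rV[K]_m -> 'rV[K]_n),
    reg _ _ D f <-> forall x, D x -> reg _ _ [set x] f;
  reg_congr : forall m n (D : set 'rV[K]_m) (f g : 'rV[K]_m -> 'rV[K]_n),
    open D -> (forall x, D x -> f x = g x) -> reg _ _ D f -> reg _ _ D g;
  reg_continuous : forall m n (D : set 'rV[K]_m) (f : 'rV[K]_m -> 'rV[K]_n) x,
    open D -> reg _ _ D f -> D x -> {for x, continuous f};
  reg_comp : forall m n p (D : set 'rV[K]_m) (D' : set 'rV[K]_n)
      (f : 'rV[K]_m -> 'rV[K]_n) (g : 'rV[K]_n -> 'rV[K]_p),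
    open D -> open D' -> (forall x, D x -> D' (f x)) ->
    reg _ _ D f -> reg _ _ D' g -> reg _ _ D (g \o f);
  reg_row : forall m n p (D : set 'rV[K]_m)
      (f : 'rV[K]_m -> 'rV[K]_n) (g : 'rV[K]_m -> 'rV[K]_p),
    open D -> reg _ _ D f -> reg _ _ D g ->
    reg _ _ D (fun x => row_mx (f x) (g x));
  reg_lsub : forall m n, reg _ _ setT (fun x : 'rV[K]_(m + n) => lsubmx x);
  reg_rsub : forall m n, reg _ _ setT (fun x : 'rV[K]_(m + n) => rsubmx x);
  reg_id : forall m, reg _ _ setT (fun x : 'rV[K]_m => x);
  reg_cst : forall m n (a : 'rV[K]_n), reg _ _ setT (fun x : 'rV[K]_m => a) }.

Lemma reg_post (K : numFieldType) (reg : regularity K) : is_regularity reg ->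
  forall m n p (D : set 'rV[K]_m)
      (f : 'rV[K]_m -> 'rV[K]_n) (g : 'rV[K]_n -> 'rV[K]_p),
    open D -> reg _ _ D f -> reg _ _ setT g -> reg _ _ D (fun x => g (f x)).
Proof. by move=> regP m n p D f g oD; exact: (reg_comp regP oD openT). Qed.

Section SmoothRegularity.
Variable R : realType.

Lemma ck_coord k m (D : set 'rV[R]_m) j : ck k D (fun x => x 0 j).
Proof.
case: k => [|k] /=; first by move=> x _; exact: coord_continuous.
split=> [x _|v]; first exact: differentiable_coord.
have -> : (fun x : 'rV[R]_m => 'D_v (fun x : 'rV[R]_m => x 0 j) x) = fun=> v 0 j.
  apply/funext => x.
  have dx : derivable (id : 'rV[R]_m -> 'rV[R]_m) x v by exact: derivable_id.
  have /matrixP/(_ 0 j) := derive_mx dx.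
  by rewrite derive_id mxE => ->.
exact: ck_cst.
Qed.

Lemma smoothP m n (D : set 'rV[R]_m) (f : 'rV[R]_m -> 'rV[R]_n) : open D ->
  smooth_on D f <-> forall k j, ck k D (fun x => f x 0 j).
Proof.
move=> oD; split=> [sf k|sf k]; first exact/CkP/sf.
by apply/CkP => //; exact: sf.
Qed.

Lemma Ck_pointwise k m n (D : set 'rV[R]_m) (f : 'rV[R]_m -> 'rV[R]_n) :
  Ck_on k D f <-> forall x, D x -> Ck_on k [set x] f.
Proof.
elim: k f => [|k IH] f /=.
  by split=> cf x Dx; [move=> _ ->|]; exact: (cf x Dx).
split=> [[df cf] x Dx|cf].
  by split=> [_ ->|v]; [exact: df|exact: (IH _).1].
split=> [x Dx|v]; first by have [+ _] := cf x Dx; exact.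
by apply/IH => x Dx; have [_] := cf x Dx.
Qed.

Lemma smooth_is_regularity : is_regularity (@smooth_on R).
Proof.
split.
- move=> m n D f; split=> [sf x Dx k|sf k].
    by move/Ck_pointwise: (sf k); apply.
  by apply/Ck_pointwise => x Dx; exact: sf.
- move=> m n D f g oD fg /(smoothP _ oD) sf; apply/(smoothP _ oD) => k j.
  by apply: (ck_congr oD _ (sf k j)) => x Dx; rewrite fg.
- by move=> m n D f x oD /(_ 0%N); exact.
- move=> m n p D D' f g oD oD' DD' sf /(smoothP _ oD') sg.
  by apply/(smoothP _ oD) => k j; exact: (ck_comp oD oD' DD' (sf k) (sg k j)).
- move=> m n p D f g oD /(smoothP _ oD) sf /(smoothP _ oD) sg.
  apply/(smoothP _ oD) => k j; case: (splitP j) => i ji.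
    have -> : j = lshift p i by exact/val_inj.
    by apply: (ck_congr oD _ (sf k i)) => x Dx; rewrite row_mxEl.
  have -> : j = rshift n i by exact/val_inj.
  by apply: (ck_congr oD _ (sg k i)) => x Dx; rewrite row_mxEr.
- move=> m n; apply/(smoothP _ openT) => k j.
  apply: (ck_congr openT _ (ck_coord k _ (lshift n j))) => x _.
  by rewrite mxE.
- move=> m n; apply/(smoothP _ openT) => k j.
  apply: (ck_congr openT _ (ck_coord k _ (rshift m j))) => x _.
  by rewrite mxE.
- by move=> m; apply/(smoothP _ openT) => k j; exact: ck_coord.
- by move=> m n a; apply/(smoothP _ openT) => k j; exact: ck_cst.
Qed.

End SmoothRegularity.

Lemma continuous_eps (K L : numFieldType) (V : normedModType K)
    (W : normedModType L) (p : V -> W) :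
  (forall e : L, 0 < e -> exists2 d : K, 0 < d &
     forall z w, `|z - w| < d -> `|p z - p w| < e) -> continuous p.
Proof.
move=> H z; apply/cvgrPdist_lt => e /H[d d0 pd].
have := nbhsx_ballx z d d0; rewrite -ball_normE; apply: filterS => w zw.
exact: pd.
Qed.

Lemma continuous2_eps (T : topologicalType) (K L : numFieldType)
    (V : normedModType L) (W : normedModType K)
    (F : V -> V -> W) (f g : T -> V) x :
  (forall e : K, 0 < e -> exists2 d : L, 0 < d & forall a b a' b',
     `|a - a'| < d -> `|b - b'| < d -> `|F a b - F a' b'| < e) ->
  {for x, continuous f} -> {for x, continuous g} ->
  {for x, continuous (fun y => F (f y) (g y))}.
Proof.
move=> H /cvgrPdist_lt cf /cvgrPdist_lt cg; apply/cvgrPdist_lt => e /H[d d0 Fd].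
near=> y; apply: Fd; near: y; [exact: cf|exact: cg].
Unshelve. all: by end_near. Qed.

Section Complex.
Variable R : realType.
Local Notation C := (Cfield R).

Lemma realifyK n : cancel (@realify R n) (@complexify R n).
Proof.
by move=> v; apply/rowP => j; rewrite mxE row_mxKl row_mxKr !mxE; case: (v 0 j).
Qed.

Lemma complexifyK n : cancel (@complexify R n) (@realify R n).
Proof.
move=> w; rewrite -[RHS]hsubmxK /realify; congr row_mx; apply/rowP => j.
  by rewrite !mxE.
by rewrite !mxE.
Qed.

Lemma ReIm_continuous :
  continuous (fun z : C => complex.Re z) /\ continuous (fun z : C => complex.Im z).
Proof.
have key (p : C -> R) : (forall z w, p (z - w) = p z - p w) ->
    (forall z, `|p z|%:C <= `|z| :> R[i]) -> continuous p.
  move=> pB pn; apply: (@continuous_eps C R C^o R^o) => e e0.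
  exists (e%:C) => [|z w zw]; first by rewrite ltcR.
  by rewrite -pB -ltcR; exact: le_lt_trans (pn _) zw.
split; apply: key => [[a b] [c d]|z] //; first exact: normc_ge_Re.
rewrite normc_def lecR; case: z => a b /=.
by rewrite -sqrtr_sqr ler_wsqrtr// lerDr sqr_ge0.
Qed.

Lemma complex_pair_continuous (T : topologicalType) (f g : T -> R) x :
  {for x, continuous f} -> {for x, continuous g} ->
  {for x, continuous (fun y => (f y +i* g y) : C)}.
Proof.
apply: (@continuous2_eps _ C R R^o C^o (fun a b => a +i* b)) => e e0.
have eE : e = (complex.Re e)%:C by rewrite RRe_real// ger0_real// ltW.
exists (complex.Re e / 2) => [|a b a' b' aa' bb'].
  by rewrite divr_gt0// -ltcR -eE.
rewrite eE normc_def ltcR /=.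
have sqrt_le (x1 x2 : R) : Num.sqrt (x1 ^+ 2 + x2 ^+ 2) <= `|x1| + `|x2|.
  rewrite -[leRHS]ger0_norm ?addr_ge0// -sqrtr_sqr ler_wsqrtr//.
  by rewrite sqrrD !real_normK ?num_real// lerD2r lerDl mulrn_wge0// mulr_ge0.
apply: le_lt_trans (sqrt_le _ _) _; rewrite (splitr (complex.Re e)).
exact: ltrD.
Qed.

Lemma realify_continuous n : continuous (@realify R n).
Proof.
have [cRe cIm] := ReIm_continuous.
move=> v; apply/continuous_coordinate => i j; case: (splitP j) => k jk.
  have -> : j = lshift n k by exact/val_inj.
  have -> : (fun y => @realify R n y i (lshift n k)) = fun y => complex.Re (y i k).
    by apply/funext => y; rewrite row_mxEl mxE.
  by apply: (continuous_comp (@coord_continuous _ _ _ i k v)); exact: cRe.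
have -> : j = rshift n k by exact/val_inj.
have -> : (fun y => @realify R n y i (rshift n k)) = fun y => complex.Im (y i k).
  by apply/funext => y; rewrite row_mxEr mxE.
by apply: (continuous_comp (@coord_continuous _ _ _ i k v)); exact: cIm.
Qed.

Lemma complexify_continuous n : continuous (@complexify R n).
Proof.
move=> v; apply/continuous_coordinate => i j.
have -> : (fun y => @complexify R n y i j) =
    fun y => (y 0 (lshift n j) +i* y 0 (rshift n j)).
  by apply/funext => y; rewrite !mxE.
apply: complex_pair_continuous; exact: coord_continuous.
Qed.

Lemma realify_imageE n (D : set 'rV[C]_n) :
  @realify R n @` D = @complexify R n @^-1` D.
Proof.
apply/seteqP; split=> [_ [v Dv <-]|w Dw] /=; first by rewrite realifyK.
by exists (complexify w) => //; rewrite complexifyK.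
Qed.

Lemma realify_open n (D : set 'rV[C]_n) : open D -> open (@realify R n @` D).
Proof.
by rewrite realify_imageE; apply: open_comp => w _; exact: complexify_continuous.
Qed.

Let smR := smooth_is_regularity R.

(** [realify] lists all the real parts before the imaginary parts, hence it
commutes with the juxtaposition of vectors only up to a permutation of the
coordinates. *)
Lemma realify_row m n (a : 'rV[C]_m) (b : 'rV[C]_n) :
  realify (row_mx a b) =
  row_mx (row_mx (lsubmx (realify a)) (lsubmx (realify b)))
         (row_mx (rsubmx (realify a)) (rsubmx (realify b))).
Proof. by rewrite /realify !row_mxKl !row_mxKr !map_row_mx. Qed.

Lemma realify_lsub m n (a : 'rV[C]_(m + n)) :
  realify (lsubmx a) =
  row_mx (lsubmx (lsubmx (realify a))) (lsubmx (rsubmx (realify a))).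
Proof. by rewrite /realify !row_mxKl !row_mxKr !map_lsubmx. Qed.

Lemma realify_rsub m n (a : 'rV[C]_(m + n)) :
  realify (rsubmx a) =
  row_mx (rsubmx (lsubmx (realify a))) (rsubmx (rsubmx (realify a))).
Proof. by rewrite /realify !row_mxKl !row_mxKr !map_rsubmx. Qed.

(** A holomorphic map is complex differentiable and smooth in the real
coordinates; each property is checked for both conditions. *)
Lemma holomorphic_is_regularity : is_regularity (@holomorphic_on R).
Proof.
split.
- move=> m n D f; split=> [[sf df] x Dx|hf].
    split=> [|_ ->]; last exact: df.
    rewrite image_set1; move/(reg_pointwise smR): sf; apply.
    exact: imageP.
  split=> [|x Dx]; last by have [_] := hf x Dx; exact.
  apply/(reg_pointwise smR) => _ [x Dx <-].
  by have [+ _] := hf x Dx; rewrite image_set1.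
- move=> m n D f g oD fg [sf df]; split=> [|x Dx].
    apply: (reg_congr smR (realify_open oD) _ sf) => _ [x Dx <-] /=.
    by rewrite realifyK fg.
  apply: differentiable_near_eq (df _ Dx); exact: near_open fg.
- by move=> m n D f x oD [_ df] /df/differentiable_continuous.
- move=> m n p D D' f g oD oD' DD' [sf df] [sg dg]; split=> [|x Dx]; last first.
    by apply: differentiable_comp; [exact: df|exact/dg/DD'].
  have -> : @realify R p \o (g \o f) \o @complexify R m =
      (@realify R p \o g \o @complexify R n) \o (@realify R n \o f \o @complexify R m).
    by apply/funext => w /=; rewrite realifyK.
  apply: (reg_comp smR (realify_open oD) (realify_open oD') _ sf sg).
  by move=> _ [x Dx <-] /=; rewrite realifyK; exact/imageP/DD'.
- move=> m n p D f g oD [sf df] [sg dg]; split=> [|x Dx]; last first.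
    by apply: differentiable_row; [exact: df|exact: dg].
  have oD' := realify_open oD.
  have -> : @realify R (n + p) \o (fun x => row_mx (f x) (g x)) \o @complexify R m =
      fun x => row_mx
       (row_mx (lsubmx ((@realify R n \o f \o @complexify R m) x))
               (lsubmx ((@realify R p \o g \o @complexify R m) x)))
       (row_mx (rsubmx ((@realify R n \o f \o @complexify R m) x))
               (rsubmx ((@realify R p \o g \o @complexify R m) x))).
    by apply/funext => x /=; rewrite realify_row.
  by apply: (reg_row smR) => //; apply: (reg_row smR) => //;
    apply: (reg_post smR) => //; do ?[exact: reg_lsub smR _ _|exact: reg_rsub smR _ _].
- move=> m n; split=> [|x _]; last exact: differentiable_lsubmx.
  have oT := realify_open (@openT 'rV[C]_(m + n)).
  have -> : @realify R m \o (fun x => lsubmx x) \o @complexify R (m + n) =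
      fun x => row_mx (lsubmx (lsubmx x)) (lsubmx (rsubmx x)).
    by apply/funext => x /=; rewrite realify_lsub complexifyK.
  apply/(reg_pointwise smR) => x _; move: x (Logic.I); apply/(reg_pointwise smR).
  apply: (reg_row smR openT).
    exact: (reg_post smR openT (reg_lsub smR _ _) (reg_lsub smR _ _)).
  exact: (reg_post smR openT (reg_rsub smR _ _) (reg_lsub smR _ _)).
- move=> m n; split=> [|x _]; last exact: differentiable_rsubmx.
  have -> : @realify R n \o (fun x => rsubmx x) \o @complexify R (m + n) =
      fun x => row_mx (rsubmx (lsubmx x)) (rsubmx (rsubmx x)).
    by apply/funext => x /=; rewrite realify_rsub complexifyK.
  apply/(reg_pointwise smR) => x _; move: x (Logic.I); apply/(reg_pointwise smR).
  apply: (reg_row smR openT).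
    exact: (reg_post smR openT (reg_lsub smR _ _) (reg_rsub smR _ _)).
  exact: (reg_post smR openT (reg_rsub smR _ _) (reg_rsub smR _ _)).
- move=> m; split=> [|x _]; last exact: ex_diff.
  have -> : @realify R m \o (fun x => x) \o @complexify R m = id.
    by apply/funext => x /=; rewrite complexifyK.
  apply/(reg_pointwise smR) => x _; move: x (Logic.I); apply/(reg_pointwise smR).
  exact: reg_id smR _.
- move=> m n a; split=> [|x _]; last exact: differentiable_cst.
  apply/(reg_pointwise smR) => x _; move: x (Logic.I); apply/(reg_pointwise smR).
  exact: reg_cst smR _ _ _.
Qed.

Lemma lie_reg_is_regularity k : is_regularity (@lie_reg R k).
Proof. by case: k; [exact: smooth_is_regularity|exact: holomorphic_is_regularity]. Qed.

End Complex.

(** * Regular maps between charted spaces *)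

Section RegularMaps.
Variables (K : numFieldType) (reg : regularity K) (regP : is_regularity reg).

Lemma reg_sub m n (D D' : set 'rV[K]_m) (f : 'rV[K]_m -> 'rV[K]_n) :
  D' `<=` D -> reg D f -> reg D' f.
Proof.
move=> DD' /(reg_pointwise regP) rf; apply/(reg_pointwise regP) => x /DD'.
exact: rf.
Qed.

(** Unlike [reg] on a given set, regularity near a point is stable under
composition and change of charts without shrinking domains explicitly. *)
Definition reg_at m n (f : 'rV[K]_m -> 'rV[K]_n) w :=
  exists W, [/\ open W, W w & reg W f].

Lemma reg_on_at m n (D : set 'rV[K]_m) (f : 'rV[K]_m -> 'rV[K]_n) w :
  nbhs w D -> reg D f -> reg_at f w.
Proof.
move=> Dw rf; exists D°; split; first exact: open_interior.
  exact: Dw.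
by apply: reg_sub rf; exact: interior_subset.
Qed.

Lemma reg_at_on m n (D : set 'rV[K]_m) (f : 'rV[K]_m -> 'rV[K]_n) :
  (forall w, D w -> reg_at f w) -> reg D f.
Proof.
move=> rf; apply/(reg_pointwise regP) => w Dw.
have [W [oO Ow rO]] := rf w Dw.
by apply: reg_sub rO => _ ->.
Qed.

Lemma reg_at_congr m n (f g : 'rV[K]_m -> 'rV[K]_n) w :
  (\forall y \near w, f y = g y) -> reg_at f w -> reg_at g w.
Proof.
pose V := [set y | f y = g y]; move=> fg [W [oO Ow rf]].
have oOW : open (W `&` V°) by apply: openI => //; exact: open_interior.
exists (W `&` V°); split=> //.
apply: (reg_congr regP) oOW _ (reg_sub _ rf) => [x [_ /interior_subset//]|].
by move=> x [].
Qed.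

Lemma reg_at_continuous m n (f : 'rV[K]_m -> 'rV[K]_n) w :
  reg_at f w -> {for w, continuous f}.
Proof. by move=> [W [oO Ow rf]]; exact: (reg_continuous regP oO rf). Qed.

Lemma reg_at_comp m n p (f : 'rV[K]_m -> 'rV[K]_n) (g : 'rV[K]_n -> 'rV[K]_p) w :
  reg_at f w -> reg_at g (f w) -> reg_at (g \o f) w.
Proof.
move=> rf [W' [oW' W'w rg]]; have cf := reg_at_continuous rf.
have [W [oO Ow rO]] := rf.
have oOW : open (W `&` interior (f @^-1` W')) by apply: openI => //; exact: open_interior.
exists (W `&` interior (f @^-1` W')); split=> //.
  by split=> //; apply: cf; exact: open_nbhs_nbhs.
apply: (reg_comp regP oOW oW') rg => [x [_ /interior_subset//]|].
by apply: reg_sub rO => x [].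
Qed.

Lemma reg_at_row m n p (f : 'rV[K]_m -> 'rV[K]_n) (g : 'rV[K]_m -> 'rV[K]_p) w :
  reg_at f w -> reg_at g w -> reg_at (fun x => row_mx (f x) (g x)) w.
Proof.
move=> [W [oO Ow rf]] [W' [oW' Ow' rg]]; have oOW := openI oO oW'.
exists (W `&` W'); split=> //.
by apply: (reg_row regP oOW); [apply: reg_sub rf|apply: reg_sub rg] => x [].
Qed.

Lemma reg_total_at m n (f : 'rV[K]_m -> 'rV[K]_n) w : reg setT f -> reg_at f w.
Proof. by move=> rf; exists setT; split=> //; exact: openT. Qed.

(** Properties that hold near a point can be used in the coordinate space of any
chart around it. *)
Lemma chart_near n (T : topologicalType) (c : chart K n T) x (P : T -> Prop) :
  is_chart c -> cdom c x -> (\forall y \near x, P y) ->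
  \forall w \near cfun c x,
    [/\ cfun c (cinv c w) = w, cdom c (cinv c w) & P (cinv c w)].
Proof.
move=> [oc oi cK _ ci] cx Px.
have ix : (cfun c @` cdom c) (cfun c x) by exact: imageP.
have Px' : \forall w \near cfun c x, P (cinv c w).
  by apply: (ci _ ix); rewrite /= cK.
near=> w.
have [y cy yw] : (cfun c @` cdom c) w by near: w; exact: open_nbhs_nbhs.
have Pw : P (cinv c w) by near: w.
by move: Pw; rewrite -yw cK.
Unshelve. all: by end_near. Qed.

(** The local conditions on a manifold, which are the ones that the calculus of
regular maps depends on. *)
Record is_atlas n (X : charted K n) : Prop := {
  atlas_chart : forall c, atlas X c -> is_chart c;
  atlas_cover : forall x : X, exists2 c, atlas X c & cdom c x;
  atlas_transition : forall c d x, atlas X c -> atlas X d -> cdom c x -> cdom d x ->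
    reg_at (cfun d \o cinv c) (cfun c x) }.

Lemma manifold_atlas n (X : charted K n) : is_manifold reg X -> is_atlas X.
Proof.
move=> [_ _ Xc Xx Xt]; split=> // c d x Ac Ad cx dx.
apply: reg_on_at (Xt c d Ac Ad).
have [oc oi cK _ _] := Xc c Ac; have [od _ _ _ _] := Xc d Ad.
have dn : \forall y \near x, cdom d y by exact: open_nbhs_nbhs.
apply: filterS (chart_near (Xc c Ac) cx dn) => w [wE cw dw].
by rewrite -wE; exact: imageP.
Qed.

Definition regular_at m n (X : charted K m) (Y : charted K n) (f : X -> Y) x :=
  {for x, continuous f} /\
  (forall c d, atlas X c -> atlas Y d -> cdom c x -> cdom d (f x) ->
     reg_at (cfun d \o f \o cinv c) (cfun c x)).

Lemma openX (S T : topologicalType) (A : set S) (B : set T) :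
  open A -> open B -> open (A `*` B).
Proof.
move=> oA oB; rewrite openE => -[x y] [Ax By].
by exists (A, B) => //=; split; exact: open_nbhs_nbhs.
Qed.

Lemma prod_chart_is_chart m n (S T : topologicalType) (c : chart K m S)
    (d : chart K n T) :
  is_chart c -> is_chart d -> is_chart (prod_chart c d).
Proof.
move=> [oc ic cK cc ci] [od id' dK dc di].
have cl : continuous (fun w : 'rV[K]_(m + n) => lsubmx w).
  by move=> w; exact: (reg_continuous regP openT (reg_lsub regP m n)).
have cr : continuous (fun w : 'rV[K]_(m + n) => rsubmx w).
  by move=> w; exact: (reg_continuous regP openT (reg_rsub regP m n)).
have imE : cfun (prod_chart c d) @` cdom (prod_chart c d) =
    (fun w => lsubmx w) @^-1` (cfun c @` cdom c) `&`
    (fun w => rsubmx w) @^-1` (cfun d @` cdom d).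
  apply/seteqP; split=> [_ [[x y] [/= cx dy] <-]|w [/= [x cx xw] [y dy yw]]].
    by split=> /=; rewrite ?row_mxKl ?row_mxKr; exact: imageP.
  by exists (x, y) => //=; rewrite xw yw hsubmxK.
split.
- exact: openX.
- rewrite imE; apply: openI; [exact: (open_comp (fun w _ => cl w) ic)|].
  exact: (open_comp (fun w _ => cr w) id').
- by move=> [x y] [/= cx dy]; rewrite row_mxKl row_mxKr cK// dK.
- move=> [x y] [/= cx dy]; apply/continuous_coordinate => i j.
  have c1 : {for (x, y), continuous (fun p : S * T => cfun c p.1)}.
    by apply: continuous_comp; [exact: cvg_fst|exact: cc].
  have c2 : {for (x, y), continuous (fun p : S * T => cfun d p.2)}.
    by apply: continuous_comp; [exact: cvg_snd|exact: dc].
  case: (splitP j) => k jk.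
    have -> : j = lshift n k by exact/val_inj.
    have -> : (fun p : S * T => row_mx (cfun c p.1) (cfun d p.2) i (lshift n k)) =
        fun p => cfun c p.1 i k by apply/funext => p; rewrite row_mxEl.
    by move/continuous_coordinate: c1; apply.
  have -> : j = rshift m k by exact/val_inj.
  have -> : (fun p : S * T => row_mx (cfun c p.1) (cfun d p.2) i (rshift m k)) =
      fun p => cfun d p.2 i k by apply/funext => p; rewrite row_mxEr.
  by move/continuous_coordinate: c2; apply.
- rewrite imE => w [lw rw].
  exact: (cvg_pair (continuous_comp (cl w) (ci _ lw))
                   (continuous_comp (cr w) (di _ rw))).
Qed.

Lemma prod_is_atlas m n (X : charted K m) (Y : charted K n) :
  is_atlas X -> is_atlas Y -> is_atlas (prod_charted X Y).
Proof.
move=> aX aY; split.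
- move=> _ [c Ac [d Ad <-]].
  by apply: prod_chart_is_chart; [exact: (atlas_chart aX)|exact: (atlas_chart aY)].
- move=> [x y]; have [c Ac cx] := atlas_cover aX x; have [d Ad dy] := atlas_cover aY y.
  by exists (prod_chart c d) => //; exists c => //; exists d.
- move=> _ _ [x y] [c Ac [d Ad <-]] [c' Ac' [d' Ad' <-]] [/= cx dy] [/= cx' dy'].
  set w := row_mx _ _; apply: reg_at_row.
    have -> : (fun u => cfun c' (cinv (prod_chart c d) u).1) =
      (cfun c' \o cinv c) \o (fun u => lsubmx u) by [].
    apply: reg_at_comp; first exact/reg_total_at/(reg_lsub regP).
    by rewrite row_mxKl; exact: (atlas_transition aX).
  have -> : (fun u => cfun d' (cinv (prod_chart c d) u).2) =
    (cfun d' \o cinv d) \o (fun u => rsubmx u) by [].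
  apply: reg_at_comp; first exact/reg_total_at/(reg_rsub regP).
  by rewrite row_mxKr; exact: (atlas_transition aY).
Qed.

Section Two.
Variables (m n : nat) (X : charted K m) (Y : charted K n).
Hypotheses (aX : is_atlas X) (aY : is_atlas Y).

(** Both sides examine the same local expressions; as charts are open maps, an
open set of [X] gives an open set of the coordinate space, on which regularity
is a local condition. *)
Lemma regular_onP (D : set X) (f : X -> Y) : open D ->
  regular_on reg D f <-> forall x, D x -> regular_at f x.
Proof.
move=> oD; split=> [[cf rf] x Dx|rf].
  split=> [|c d Ac Ad cx dx]; first exact: cf.
  apply: reg_on_at (rf c d Ac Ad).
  have [oc _ _ _ _] := atlas_chart aX Ac; have [od _ _ _ _] := atlas_chart aY Ad.
  have : \forall y \near x, (D `&` f @^-1` cdom d) y.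
    apply: filterI; first exact: open_nbhs_nbhs.
    by apply: (cf x Dx); exact: open_nbhs_nbhs.
  move=> /(chart_near (atlas_chart aX Ac) cx); apply: filterS => w [wE cw [Dw dw]].
  by rewrite -wE; exact: imageP.
split=> [x Dx|c d Ac Ad]; first exact: (rf x Dx).1.
apply: reg_at_on => _ [x [[Dx cx] dx] <-].
exact: (rf x Dx).2.
Qed.

(** The expressions of [f] in two pairs of charts differ by transition maps, so
that one pair of charts is enough. *)
Lemma regular_at_chart (f : X -> Y) x c d :
  atlas X c -> atlas Y d -> cdom c x -> cdom d (f x) ->
  {for x, continuous f} -> reg_at (cfun d \o f \o cinv c) (cfun c x) ->
  regular_at f x.
Proof.
move=> Ac Ad cx dx cf rf; split=> // c' d' Ac' Ad' cx' dx'.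
have [oc _ cK _ _] := atlas_chart aX Ac; have [od _ dK _ _] := atlas_chart aY Ad.
have [_ _ cK' _ _] := atlas_chart aX Ac'.
have E : \forall w \near cfun c' x,
   ((cfun d' \o cinv d) \o ((cfun d \o f \o cinv c) \o (cfun c \o cinv c'))) w =
   (cfun d' \o f \o cinv c') w.
  have : \forall y \near x, (cdom c `&` f @^-1` cdom d) y.
    apply: filterI; first exact: open_nbhs_nbhs.
    by apply: cf; exact: open_nbhs_nbhs.
  move=> /(chart_near (atlas_chart aX Ac') cx'); apply: filterS => w [_ _ [cw dw]].
  by rewrite /= cK// dK.
apply: reg_at_congr E _; apply: reg_at_comp.
  apply: reg_at_comp; first exact: atlas_transition.
  by rewrite /= cK'.
by rewrite /= cK'// cK//; exact: atlas_transition.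
Qed.

Lemma regular_at_congr (f g : X -> Y) x :
  (\forall y \near x, f y = g y) -> regular_at f x -> regular_at g x.
Proof.
move=> fg [cf rf]; have fgx := nbhs_singleton fg.
split=> [|c d Ac Ad cx dx]; first exact: continuous_near_eq cf.
apply: reg_at_congr (rf c d Ac Ad cx _); last by rewrite fgx.
apply: filterS (chart_near (atlas_chart aX Ac) cx fg) => w [_ _ /=].
by move=> ->.
Qed.

Lemma regular_at_cst (y : Y) x : regular_at (fun _ : X => y) x.
Proof.
split=> [|c d _ _ _ _]; first exact: cst_continuous.
exact/reg_total_at/(reg_cst regP).
Qed.

Lemma regular_at_fst p : regular_at (X := prod_charted X Y) (Y := X) fst p.
Proof.
split=> [|_ d [c Ac [c' Ac' <-]] Ad [/= cp cp'] dp]; first exact: cvg_fst.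
set w := row_mx _ _.
have wE : lsubmx w = cfun c p.1 by rewrite row_mxKl.
have -> : cfun d \o fst \o cinv (prod_chart c c') = (cfun d \o cinv c) \o lsubmx.
  by apply/funext.
apply: reg_at_comp; first exact/reg_total_at/(reg_lsub regP).
by rewrite wE; exact: atlas_transition.
Qed.

Lemma regular_at_snd p : regular_at (X := prod_charted X Y) (Y := Y) snd p.
Proof.
split=> [|_ d [c Ac [c' Ac' <-]] Ad [/= cp cp'] dp]; first exact: cvg_snd.
set w := row_mx _ _.
have wE : rsubmx w = cfun c' p.2 by rewrite row_mxKr.
have -> : cfun d \o snd \o cinv (prod_chart c c') = (cfun d \o cinv c') \o rsubmx.
  by apply/funext.
apply: reg_at_comp; first exact/reg_total_at/(reg_rsub regP).
by rewrite wE; exact: atlas_transition.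
Qed.

End Two.

Lemma regular_at_id n (X : charted K n) x : is_atlas X ->
  regular_at (X := X) (Y := X) (fun y => y) x.
Proof.
move=> aX; split=> [|c d Ac Ad cx dx]; first exact: cvg_id.
exact: (atlas_transition aX).
Qed.

(** Near [x], the local expression of the composite factors through a chart of
[Y] around [f x]. *)
Lemma regular_at_comp m n p (X : charted K m) (Y : charted K n) (Z : charted K p)
    (f : X -> Y) (g : Y -> Z) x :
  is_atlas X -> is_atlas Y ->
  regular_at f x -> regular_at g (f x) -> regular_at (fun y => g (f y)) x.
Proof.
move=> aX aY [cf rf] [cg rg].
split=> [|c e Ac Ae cx ex]; first exact: continuous_comp.
have [d Ad dx] := atlas_cover aY (f x).
have [od _ dK _ _] := atlas_chart aY Ad.
have [_ _ cK _ _] := atlas_chart aX Ac.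
have dn : \forall y \near x, cdom d (f y) by apply: cf; exact: open_nbhs_nbhs.
have E : \forall w \near cfun c x,
   ((cfun e \o g \o cinv d) \o (cfun d \o f \o cinv c)) w =
   (cfun e \o (fun y => g (f y)) \o cinv c) w.
  apply: filterS (chart_near (atlas_chart aX Ac) cx dn) => w [_ _ dw].
  by rewrite /= dK.
apply: reg_at_congr E _; apply: reg_at_comp; first exact: rf.
by rewrite /= cK//; exact: rg.
Qed.

Lemma regular_at_pair m n p (X : charted K m) (Y : charted K n) (Z : charted K p)
    (f : X -> Y) (g : X -> Z) x :
  regular_at f x -> regular_at g x ->
  regular_at (Y := prod_charted Y Z) (fun y => (f y, g y)) x.
Proof.
move=> [cf rf] [cg rg].
split=> [|c _ Ac [d Ad [e Ae <-]] cx [/= dx ex]]; first exact: cvg_pair.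
by apply: reg_at_row; [exact: rf|exact: rg].
Qed.

Lemma line_is_atlas : is_atlas (line_charted K).
Proof.
have cf : continuous (fun z : K => const_mx z : 'rV[K]_1).
  move=> z; apply/continuous_coordinate => i j.
  have -> : (fun y : K => (const_mx y : 'rV[K]_1) i j) = id.
    by apply/funext => y; rewrite mxE.
  exact: cvg_id.
have imE : (fun z : K => const_mx z : 'rV[K]_1) @` setT = setT.
  apply/seteqP; split=> // w _; exists (w 0 0) => //.
  by apply/rowP => j; rewrite mxE (ord1 j).
split.
- move=> _ ->; split=> /=.
  + exact: openT.
  + by rewrite imE; exact: openT.
  + by move=> x _; rewrite mxE.
  + by move=> x _; exact: cf.
  + by move=> w _; exact: coord_continuous.
- by move=> z; eexists; first reflexivity.
- move=> _ _ z -> -> _ _ /=.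
  have -> : (fun z : K => const_mx z : 'rV[K]_1) \o (fun w : 'rV[K]_1 => w 0 0) =
      fun w => w.
    by apply/funext => w; apply/rowP => j; rewrite mxE (ord1 j).
  exact/reg_total_at/(reg_id regP).
Qed.

End RegularMaps.

(** * Underlying real manifolds, and the arithmetic of complex functions *)

Section Underlying.
Variable R : realType.
Local Notation C := (Cfield R).
Local Notation C1 := (line_charted (Cfield R)).
Local Notation hol := (@holomorphic_on R).
Local Notation holP := holomorphic_is_regularity.
Local Notation smP := smooth_is_regularity.

Lemma reg_at_realify m n (f : 'rV[C]_m -> 'rV[C]_n) w :
  reg_at hol f w ->
  reg_at (@smooth_on R) (@realify R n \o f \o @complexify R m) (realify w).
Proof.
move=> [W [oW Ww [sf _]]]; exists (@realify R m @` W); split=> //.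
exact: realify_open.
Qed.

Lemma underlying_cdom k n (T : topologicalType) (c : chart C n T) :
  cdom (underlying_chart k c) = cdom c.
Proof. by case: k. Qed.

Lemma underlying_is_chart k n (T : topologicalType) (c : chart C n T) :
  is_chart c -> is_chart (underlying_chart k c).
Proof.
case: k; last by [].
move=> [oc ic cK cc ci]; rewrite /underlying_chart.
have imE : (@realify R n \o cfun c) @` cdom c = @realify R n @` (cfun c @` cdom c).
  by rewrite image_comp.
split; rewrite /= ?[[set _ | _ in _]]imE.
- by [].
- exact: realify_open.
- by move=> x cx; rewrite realifyK cK.
- by move=> x cx; apply: continuous_comp; [exact: cc|exact: realify_continuous].
- move=> _ [w cw <-]; apply: continuous_comp; first exact: complexify_continuous.
  by rewrite realifyK; exact: ci.
Qed.

Lemma underlying_is_atlas k n (X : charted C n) :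
  is_atlas hol X -> is_atlas (@lie_reg R k) (underlying k X).
Proof.
move=> aX; split.
- by move=> _ [c Ac <-]; apply/underlying_is_chart/(atlas_chart aX).
- move=> x; have [c Ac cx] := atlas_cover aX x.
  by exists (underlying_chart k c); [exists c|rewrite underlying_cdom].
- move=> _ _ x [c Ac <-] [d Ad <-]; rewrite !underlying_cdom.
  case: k x => /= x cx dx; last first.
    exact: (atlas_transition aX).
  exact: (reg_at_realify (atlas_transition aX Ac Ad cx dx)).
Qed.

Lemma underlying_regular_at k m n (X : charted C m) (Y : charted C n) (f : X -> Y) x :
  regular_at hol f x ->
  regular_at (X := underlying k X) (Y := underlying k Y) (@lie_reg R k) f x.
Proof.
move=> [cf rf]; split=> // _ _ [c Ac <-] [d Ad <-]; case: k => /= cx dx; last first.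
  exact: rf.
exact: (reg_at_realify (rf c d Ac Ad cx dx)).
Qed.

(** The real charts of a product of complex manifolds are not the products of
the real charts: [realify] permutes the coordinates, whence this variant of
[regular_at_pair]. *)
Lemma regular_at_underlying_pair k m n p (X : charted (lie_field R k) m)
    (Y : charted C n) (Z : charted C p) (f : X -> Y) (g : X -> Z) x :
  regular_at (Y := underlying k Y) (@lie_reg R k) f x ->
  regular_at (Y := underlying k Z) (@lie_reg R k) g x ->
  regular_at (Y := underlying k (prod_charted Y Z)) (@lie_reg R k)
    (fun y => (f y, g y)) x.
Proof.
move=> [cf rf] [cg rg].
split=> [|c _ Ac [_ [d Ad [e Ae <-]] <-] cx dx]; first exact: cvg_pair.
move: dx; rewrite underlying_cdom => -[/= dx ex].
have := rf c (underlying_chart k d) Ac (imageP _ Ad) cx.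
have := rg c (underlying_chart k e) Ac (imageP _ Ae) cx.
rewrite !underlying_cdom => /(_ ex) Rg /(_ dx) Rf {rf rg}.
case: k X f g x cf cg c Ac cx dx ex Rg Rf => /= X f g x cf cg c Ac cx dx ex Rg Rf.
  have -> : (@realify R (n + p) \o (fun q => row_mx (cfun d q.1) (cfun e q.2))) \o
       (fun y => (f y, g y)) \o cinv c =
     fun w => row_mx
       (row_mx (lsubmx (((@realify R n \o cfun d) \o f \o cinv c) w))
               (lsubmx (((@realify R p \o cfun e) \o g \o cinv c) w)))
       (row_mx (rsubmx (((@realify R n \o cfun d) \o f \o cinv c) w))
               (rsubmx (((@realify R p \o cfun e) \o g \o cinv c) w))).
    by apply/funext => w /=; rewrite realify_row.
  have L q (h : _ -> 'rV_(q + q)) : reg_at (@smooth_on R) h (cfun c x) ->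
      reg_at (@smooth_on R) (fun w => lsubmx (h w)) (cfun c x).
    move=> Rh; apply: (reg_at_comp (smP R) Rh); exact/reg_total_at/(reg_lsub (smP R)).
  have L' q (h : _ -> 'rV_(q + q)) : reg_at (@smooth_on R) h (cfun c x) ->
      reg_at (@smooth_on R) (fun w => rsubmx (h w)) (cfun c x).
    move=> Rh; apply: (reg_at_comp (smP R) Rh); exact/reg_total_at/(reg_rsub (smP R)).
  by do 2?[apply: (reg_at_row (smP R))]; do ?[exact: L|exact: L'].
exact: (reg_at_row (holP R)).
Qed.

(** Reduces the holomorphy of a function to the smoothness of its real and
imaginary parts, which are rational functions of the coordinates below. *)
Lemma holo_scalar m (D : set 'rV[C]_m) (h : 'rV[C]_m -> C) : open D ->
  (forall k, ck k (@realify R m @` D) (fun w => complex.Re (h (complexify w)))) ->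
  (forall k, ck k (@realify R m @` D) (fun w => complex.Im (h (complexify w)))) ->
  (forall x, D x -> differentiable (h : _ -> C^o) x) ->
  hol D (fun v => const_mx (h v) : 'rV[C]_1).
Proof.
move=> oD hre him dh; split=> [|x Dx]; last first.
  apply/differentiable_coordinate => j; rewrite (ord1 j).
  have -> : (fun y => (const_mx (h y) : 'rV[C]_1) 0 0) = h.
    by apply/funext => y; rewrite mxE.
  exact: dh.
apply/smoothP; first exact: realify_open.
move=> k j; apply: (ck_congr (realify_open oD)) => [w _|].
  move: j; pose F w := row_mx (const_mx (complex.Re (h (complexify w))) : 'rV[R]_1)
     (const_mx (complex.Im (h (complexify w))) : 'rV[R]_1).
  move=> j; transitivity (F w 0 j); first reflexivity.
  by rewrite /F /= /realify !map_const_mx.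
case: (splitP j) => i ji.
  have -> : j = lshift 1 i by exact/val_inj.
  apply: (ck_congr (realify_open oD) _ (hre k)) => w _.
  by rewrite row_mxEl mxE.
have -> : j = rshift 1 i by exact/val_inj.
apply: (ck_congr (realify_open oD) _ (him k)) => w _.
by rewrite row_mxEr mxE.
Qed.

Lemma regular_at_mul (p : C * C) :
  regular_at (X := prod_charted C1 C1) (Y := C1) hol (fun q => q.1 * q.2) p.
Proof.
split=> [|_ _ [_ -> [_ -> <-]] -> _ _]; first exact: mul_continuous.
apply: reg_total_at => /=.
have oT := realify_open (@openT 'rV[C]_(1 + 1)).
have cE (i : 'I_(1 + 1)) (w : 'rV[R]_((1 + 1) + (1 + 1))) :
    complexify w 0 i = w 0 (lshift _ i) +i* w 0 (rshift _ i) by rewrite !mxE.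
apply: (@holo_scalar _ setT (fun w : 'rV[C]_(1 + 1) => lsubmx w 0 0 * rsubmx w 0 0)).
- exact: openT.
- move=> k; apply: (ck_congr oT _ (ckD oT (ckM oT
      (ck_coord k _ (lshift _ (lshift 1 0))) (ck_coord k _ (lshift _ (rshift 1 0))))
      (ckN oT (ckM oT
      (ck_coord k _ (rshift _ (lshift 1 0))) (ck_coord k _ (rshift _ (rshift 1 0)))))))
      => w _.
  by rewrite [lsubmx _ 0 0]mxE [rsubmx _ 0 0]mxE !cE.
- move=> k; apply: (ck_congr oT _ (ckD oT (ckM oT
      (ck_coord k _ (lshift _ (lshift 1 0))) (ck_coord k _ (rshift _ (rshift 1 0))))
      (ckM oT
      (ck_coord k _ (rshift _ (lshift 1 0))) (ck_coord k _ (lshift _ (rshift 1 0))))))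
      => w _.
  by rewrite [lsubmx _ 0 0]mxE [rsubmx _ 0 0]mxE !cE.
- move=> x _; apply: (@differentiableM C).
    apply: (@differentiable_comp C _ _ _ _ (fun v : 'rV[C]_1 => v 0 0)).
      exact: differentiable_lsubmx.
    exact: differentiable_coord.
  apply: (@differentiable_comp C _ _ _ _ (fun v : 'rV[C]_1 => v 0 0)).
    exact: differentiable_rsubmx.
  exact: differentiable_coord.
Qed.

Lemma regular_at_inv (z : C) : z != 0 ->
  regular_at (X := C1) (Y := C1) hol (fun q => q^-1) z.
Proof.
move=> z0; split=> [|_ _ -> -> _ _]; first exact: inv_continuous.
have oD : open [set w : 'rV[C]_1 | w 0 0 != 0].
  have /hausdorff_accessible/accessible_closed_set1/(_ 0) := @norm_hausdorff _ C^o.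
  rewrite -openC => o0.
  have -> : [set w : 'rV[C]_1 | w 0 0 != 0] = (fun w => w 0 0) @^-1` (~` [set 0]).
    by apply/seteqP; split=> w /= /eqP.
  exact: (open_comp (fun w _ => @coord_continuous C _ _ 0 0 w) o0).
have oD' := realify_open oD.
exists [set w : 'rV[C]_1 | w 0 0 != 0]; split=> //=; first by rewrite mxE.
have n0 w : (@realify R 1 @` [set w : 'rV[C]_1 | w 0 0 != 0]) w ->
    w 0 (lshift 1 0) * w 0 (lshift 1 0) +
    w 0 (rshift 1 0) * w 0 (rshift 1 0) != 0.
  rewrite realify_imageE /= !mxE; apply: contra_neq => /eqP.
  by rewrite paddr_eq0 -?expr2 ?sqr_ge0// !sqrf_eq0 => /andP[/eqP-> /eqP->].
have cn k : ck k (@realify R 1 @` [set w : 'rV[C]_1 | w 0 0 != 0])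
    (fun w => (w 0 (lshift 1 0) * w 0 (lshift 1 0) +
      w 0 (rshift 1 0) * w 0 (rshift 1 0))^-1).
  by apply: ckV => //; apply: ckD => //; apply: ckM => //; exact: ck_coord.
apply: (@holo_scalar _ _ (fun w : 'rV[C]_1 => (w 0 0)^-1)) => //.
- move=> k; apply: (ck_congr oD' _ (ckM oD' (ck_coord k _ (lshift 1 0)) (cn k))) => w _.
  by rewrite !mxE /= !expr2.
- move=> k; apply: (ck_congr oD' _ (ckN oD'
      (ckM oD' (ck_coord k _ (rshift 1 0)) (cn k)))) => w _.
  by rewrite !mxE /= !expr2.
- move=> x x0; apply: (@differentiableV C) => //; exact: differentiable_coord.
Qed.

End Underlying.

(** * Groups of classes *)

Section ClassGroups.

Section Quotient.
Variables (T S : Type) (equiv : T -> T -> Prop) (mul : T -> T -> T -> Prop).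
Variables (cls : T -> S) (op : T -> T -> T) (one : T) (inv : T -> T).
Hypothesis clsE : forall x y, cls x = cls y <-> equiv x y.
Hypothesis mulE : forall x y z, mul x y z <-> equiv (op x y) z.
Hypothesis op_equiv : forall x x' y y',
  equiv x x' -> equiv y y' -> equiv (op x y) (op x' y').
Hypothesis opA : forall x y z, equiv (op x (op y z)) (op (op x y) z).
Hypothesis opC : forall x y, equiv (op x y) (op y x).
Hypothesis op1 : forall x, equiv (op one x) x.
Hypothesis opV : forall x, equiv (op (inv x) x) one.

(** The classes are named by the values of a complete invariant [cls], because
[T] may be too large for its subsets to form the carrier of a group. *)
Definition classes := {s : S | exists x, cls x = s}.
Let class (x : T) : classes := exist _ (cls x) (ex_intro _ x erefl).
Let repr (a : classes) : T := sval (cid (proj2_sig a)).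

Let classE x y : class x = class y <-> equiv x y.
Proof.
split=> [[/clsE//]|/clsE xy].
by apply: eq_exist.
Qed.

Let reprK a : class (repr a) = a.
Proof. by case: a => s sP; apply: eq_exist; exact: proj2_sig (cid sP). Qed.

Let add a b := class (op (repr a) (repr b)).

Let addE x y : add (class x) (class y) = class (op x y).
Proof. by apply/classE/op_equiv; apply/classE; rewrite reprK. Qed.

Let addA : associative add.
Proof.
move=> a b c; rewrite -(reprK a) -(reprK b) -(reprK c) !addE.
exact/classE/opA.
Qed.

Let addC : commutative add.
Proof. by move=> a b; apply/classE/opC. Qed.

Let add0 : left_id (class one) add.
Proof. by move=> a; rewrite -(reprK a) addE; apply/classE/op1. Qed.

Let addN : left_inverse (class one) (fun a => class (inv (repr a))) add.
Proof. by move=> a; rewrite -{2}(reprK a) addE; apply/classE/opV. Qed.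

HB.instance Definition _ := gen_eqMixin classes.
HB.instance Definition _ := gen_choiceMixin classes.
HB.instance Definition _ := GRing.isZmodule.Build classes addA addC add0 addN.

Lemma classGroup_quotient : inhabited (classGroup equiv mul).
Proof.
constructor; apply: (@ClassGroup _ _ _ classes class).
- by move=> a; exists (repr a).
- exact: classE.
- move=> x y z; rewrite mulE -classE.
  have -> : (class x : (classes : zmodType)) + class y = class (op x y) by exact: addE.
  by split=> ->.
Qed.

End Quotient.

Variables (T T' : Type) (equiv : T -> T -> Prop) (mul : T -> T -> T -> Prop).
Variables (equiv' : T' -> T' -> Prop) (mul' : T' -> T' -> T' -> Prop).
Variable f : T' -> T.
Hypothesis f_equiv : forall x y, equiv' x y <-> equiv (f x) (f y).
Hypothesis f_mul : forall x y z, mul' x y z <-> mul (f x) (f y) (f z).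
Hypothesis f_surj : forall y, exists x, equiv (f x) y.

Lemma classGroup_transfer :
  inhabited (classGroup equiv mul) -> inhabited (classGroup equiv' mul').
Proof.
case=> H; constructor.
apply: (@ClassGroup _ _ _ (cg_group H) (fun x => cg_class H (f x))).
- move=> a; have [y <-] := cg_surj a; have [x xy] := f_surj y.
  by exists x; apply/cg_equiv.
- by move=> x y; rewrite cg_equiv f_equiv.
- by move=> x y z; rewrite cg_mul f_mul.
Qed.

Lemma classGroup_iso (P : classGroup equiv' mul') (H : classGroup equiv mul) :
  exists g : {additive P -> H}, bijective g.
Proof.
pose rep (a : P) : T' := sval (cid (cg_surj a)).
have repK a : cg_class P (rep a) = a by exact: proj2_sig (cid (cg_surj a)).
pose g a := cg_class H (f (rep a)).
have gE x : g (cg_class P x) = cg_class H (f x).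
  by apply/cg_equiv/f_equiv/(cg_equiv P); rewrite repK.
have gD a b : g (a + b) = g a + g b.
  by apply/cg_mul/f_mul/(cg_mul P); rewrite !repK.
have g0 : g 0 = 0 by apply: (addrI (g 0)); rewrite -gD !addr0.
have gN a : g (- a) = - g a by apply: (addrI (g a)); rewrite -gD !subrr.
have gB : additive g by move=> a b; rewrite gD gN.
exists (HB.pack_for {additive P -> H} g (GRing.isZmodMorphism.Build P H g gB)).
pose rep' (b : H) : T := sval (cid (cg_surj b)).
have rep'K b : cg_class H (rep' b) = b by exact: proj2_sig (cid (cg_surj b)).
pose h b := cg_class P (sval (cid (f_surj (rep' b)))).
have hK b : g (h b) = b.
  rewrite gE -[RHS]rep'K; apply/cg_equiv; exact: proj2_sig (cid (f_surj _)).
exists h => // a.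
apply: (_ : injective g) => [x y|]; last by rewrite hK.
by rewrite -(repK x) -(repK y) !gE => /cg_equiv/f_equiv/(cg_equiv P).
Qed.

End ClassGroups.

(** * Cochains and cocycles *)

Section Cocycles.
Variables (R : realType) (k : lie_kind) (m n : nat).
Variables (G : lieGroup R k m) (M : complexManifold R n) (rho : action G M).
Local Notation C := (Cfield R).
Local Notation C1 := (line_charted (Cfield R)).
Local Notation hol := (@holomorphic_on R).
Local Notation rk := (@lie_reg R k).
Local Notation GM := (prod_charted (lg_charted G) (underlying k M)).

Let holP := holomorphic_is_regularity R.
Let rkP := lie_reg_is_regularity R k.

Lemma cm_atlas (X : complexManifold R n) : is_atlas hol X.
Proof. exact/manifold_atlas/cm_manifold. Qed.

Let aM : is_atlas hol M := cm_atlas M.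
Let aC1 : is_atlas hol C1 := line_is_atlas holP.
Let aG : is_atlas rk (lg_charted G) := manifold_atlas rkP (lg_manifold G).
Let aUM : is_atlas rk (underlying k M) := underlying_is_atlas k aM.
Let aUC1 : is_atlas rk (underlying k C1) := underlying_is_atlas k aC1.
Let aGM : is_atlas rk GM := prod_is_atlas rkP aG aUM.

(** Holomorphic functions on [M] and, in [regC], functions on [G * M] that are
smooth or holomorphic according to the kind of [G]. *)
Definition holC (f : M -> C) (x : M) : Prop :=
  regular_at (X := M) (Y := C1) hol f x.
Definition regC (f : G * M -> C) (p : G * M) : Prop :=
  regular_at (X := GM) (Y := underlying k C1) rk f p.

Lemma act_continuous : continuous (fun p : G * M => rho p.1 p.2).
Proof. by move=> p; exact: (act_regular rho).1. Qed.

Lemma act_continuous1 g : continuous (rho g).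
Proof. by move=> x; exact: (act_holo rho g).1. Qed.

Lemma act_holo_at g x : regular_at (X := M) (Y := M) hol (rho g) x.
Proof. exact: (regular_onP holP aM aM _ openT).1 (act_holo rho g) x Logic.I. Qed.

Lemma act_regular_at p :
  regular_at (X := GM) (Y := underlying k M) rk (fun p : G * M => rho p.1 p.2) p.
Proof. exact: (regular_onP rkP aGM aUM _ openT).1 (act_regular rho) p Logic.I. Qed.

Lemma actK g : cancel (rho g) (rho g^-1%g).
Proof. by move=> x; rewrite -actM mulVg act1. Qed.

Lemma cochain0P (U : openCover M) (mu : cochain0 U) :
  is_cochain0 mu <-> forall a x, U a x -> holC (mu a) x /\ mu a x != 0.
Proof.
split=> [cmu a x ax|cmu a].
  have [hmu mu0] := cmu a; split; last exact: mu0.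
  exact: (regular_onP holP aM aC1 _ (oc_open a)).1 hmu x ax.
split=> [|x /cmu[]//].
by apply/(regular_onP holP aM aC1 _ (oc_open a)) => x /cmu[].
Qed.

Lemma cochain1P (U : openCover M) (L : cochain1 G U) :
  is_cochain1 rho L <-> forall a b g x, U b x -> U a (rho g x) ->
    [/\ regC (fun p => L a b p.1 p.2) (g, x), holC (L a b g) x & L a b g x != 0].
Proof.
have oJ a b : open [set p : G * M | U b p.2 /\ U a (rho p.1 p.2)].
  apply: openI.
    apply: (open_comp (f := snd) (D := U b)); last exact: oc_open.
    by move=> p _; exact: cvg_snd.
  apply: (open_comp (D := U a)); last exact: oc_open.
  by move=> p _; exact: act_continuous.
have oH a b g : open (U b `&` rho g @^-1` U a).
  apply: openI; first exact: oc_open.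
  apply: (open_comp (D := U a)); last exact: oc_open.
  by move=> p _; exact: act_continuous1.
split=> [cL a b g x bx ax|cL a b].
  have [jL hL L0] := cL a b; split; last exact: L0.
    exact: (regular_onP rkP aGM aUC1 _ (oJ a b)).1 jL (g, x) (conj bx ax).
  exact: (regular_onP holP aM aC1 _ (oH a b g)).1 (hL g) x (conj bx ax).
split.
- by apply/(regular_onP rkP aGM aUC1 _ (oJ a b)) => -[g x] [bx ax]; case: (cL a b g x bx ax).
- move=> g; apply/(regular_onP holP aM aC1 _ (oH a b g)) => x [bx ax].
  by case: (cL a b g x bx ax).
- by move=> g x bx ax; case: (cL a b g x bx ax).
Qed.

Lemma holC_cst z x : holC (fun=> z) x.
Proof. exact: (regular_at_cst holP). Qed.

Lemma holC_mul f g x : holC f x -> holC g x -> holC (fun y => f y * g y) x.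
Proof.
move=> hf hg; apply: (regular_at_comp holP aM (prod_is_atlas holP aC1 aC1)
  (regular_at_pair holP hf hg) (regular_at_mul _)).
Qed.

Lemma holC_inv f x : f x != 0 -> holC f x -> holC (fun y => (f y)^-1) x.
Proof.
move=> f0 hf; exact: (regular_at_comp holP aM aC1 hf (regular_at_inv f0)).
Qed.

Lemma regC_cst z p : regC (fun=> z) p.
Proof. exact: (regular_at_cst rkP). Qed.

Lemma regC_mul f g p : regC f p -> regC g p -> regC (fun y => f y * g y) p.
Proof.
move=> hf hg; apply: (regular_at_comp rkP aGM
  (underlying_is_atlas k (prod_is_atlas holP aC1 aC1))
  (regular_at_underlying_pair hf hg)
  (underlying_regular_at k (regular_at_mul _))).
Qed.

Lemma regC_inv f p : f p != 0 -> regC f p -> regC (fun y => (f y)^-1) p.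
Proof.
move=> f0 hf; exact: (regular_at_comp rkP aGM aUC1 hf
  (underlying_regular_at k (regular_at_inv f0))).
Qed.

Lemma cocycleP (U : openCover M) (L : cochain1 G U) :
  is_cocycle rho L <->
  (forall a b g x, U b x -> U a (rho g x) ->
    [/\ regC (fun p => L a b p.1 p.2) (g, x), holC (L a b g) x & L a b g x != 0]) /\
  (forall a b c g h x, U c x -> U b (rho h x) -> U a (rho g (rho h x)) ->
    L a c (g * h)%g x = L a b g (rho h x) * L b c h x).
Proof.
split=> [[/cochain1P cL LD]|[cL LM]].
  split=> // a b c g h x cx bx ax.
  have [_ _ L1] := cL _ _ _ _ cx bx; have [_ _ L2] := cL _ _ _ _ bx ax.
  apply/(divIf (mulf_neq0 L2 L1)); rewrite divff ?mulf_neq0//; exact: LD.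
split=> [|a b c g h x cx bx ax]; first exact/cochain1P.
have [_ _ L1] := cL _ _ _ _ cx bx; have [_ _ L2] := cL _ _ _ _ bx ax.
by rewrite /D1 (LM _ _ _ _ _ _ cx bx ax) divff// mulf_neq0.
Qed.

Section CocycleTheory.
Variables (U : openCover M) (L : cochain1 G U) (cL : is_cocycle rho L).

Lemma cocycleM a b c g h x : U c x -> U b (rho h x) -> U a (rho g (rho h x)) ->
  L a c (g * h)%g x = L a b g (rho h x) * L b c h x.
Proof. by move/cocycleP: cL => [_]; exact. Qed.

Lemma cocycle_neq0 a b g x : U b x -> U a (rho g x) -> L a b g x != 0.
Proof. by move/cocycleP: cL => [+ _] bx ax => /(_ _ _ _ _ bx ax)[]. Qed.

Lemma cocycle_holC a b g x : U b x -> U a (rho g x) -> holC (L a b g) x.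
Proof. by move/cocycleP: cL => [+ _] bx ax => /(_ _ _ _ _ bx ax)[]. Qed.

Lemma cocycle_regC a b g x : U b x -> U a (rho g x) ->
  regC (fun p => L a b p.1 p.2) (g, x).
Proof. by move/cocycleP: cL => [+ _] bx ax => /(_ _ _ _ _ bx ax)[]. Qed.

(** For the neutral element of [G], a cocycle consists of the transition
functions of a line bundle. *)
Lemma transM a b c x : U a x -> U b x -> U c x ->
  L a c 1%g x = L a b 1%g x * L b c 1%g x.
Proof.
move=> ax bx cx; have := @cocycleM a b c 1%g 1%g x.
by rewrite !act1 mulg1; exact.
Qed.

Lemma trans1 a x : U a x -> L a a 1%g x = 1.
Proof.
move=> ax; have L0 : L a a 1%g x != 0 by apply: cocycle_neq0; rewrite ?act1.
by apply: (mulfI L0); rewrite -transM// mulr1.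
Qed.

Lemma transV a b x : U a x -> U b x -> L a b 1%g x * L b a 1%g x = 1.
Proof. by move=> ax bx; rewrite -transM// trans1. Qed.

Lemma trans_neq0 a b x : U a x -> U b x -> L a b 1%g x != 0.
Proof. by move=> ax bx; apply: cocycle_neq0; rewrite ?act1. Qed.

Lemma trans_holC a b x : U a x -> U b x -> holC (L a b 1%g) x.
Proof. by move=> ax bx; apply: cocycle_holC; rewrite ?act1. Qed.

(** The cocycle identity for the factorisation of [g] as [1 * g * 1]. *)
Lemma cocycle_change a a' b b' g x :
  U a (rho g x) -> U a' (rho g x) -> U b x -> U b' x ->
  L a' b' g x = L a' a 1%g (rho g x) * L a b g x * L b b' 1%g x.
Proof.
move=> ax ax' bx bx'.
have := @cocycleM a' a b' 1%g g x; rewrite act1 mul1g => ->//.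
rewrite -mulrA; congr (_ * _).
by have := @cocycleM a b b' g 1%g x; rewrite act1 mulg1 => ->.
Qed.

End CocycleTheory.

End Cocycles.

(** * The cohomology group *)

Section CohomologyGroup.
Variables (R : realType) (k : lie_kind) (m n : nat).
Variables (G : lieGroup R k m) (M : complexManifold R n) (rho : action G M).
Local Notation C := (Cfield R).
Local Notation openCover := (openCover M).
Local Notation cocycle := (cocycle rho).
Local Notation cofun L := (@coc_fun _ _ _ _ G M rho L).

Lemma cohomologousP (U : openCover) (L L' : cochain1 G U) :
  (forall a b g x, U b x -> U a (rho g x) -> L a b g x != 0) ->
  cohomologous rho L L' <->
  exists2 mu : cochain0 U, is_cochain0 mu &
    forall a b g x, U b x -> U a (rho g x) ->
      L' a b g x * mu b x = mu a (rho g x) * L a b g x.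
Proof.
move=> L0; split=> -[mu cmu muE]; exists mu => // a b g x bx ax.
  have [_ mub0] := (cochain0P mu).1 cmu b x bx.
  by apply/eqP; rewrite -eqr_div ?L0//; apply/eqP; exact: muE.
have [_ mub0] := (cochain0P mu).1 cmu b x bx.
by apply/eqP; rewrite /D0 eqr_div ?L0//; apply/eqP; exact: muE.
Qed.

Lemma eq_cohomologous (U : openCover) (L L' : cochain1 G U) :
  (forall a b g x, U b x -> U a (rho g x) -> L a b g x != 0) ->
  (forall a b g x, U b x -> U a (rho g x) -> L' a b g x = L a b g x) ->
  cohomologous rho L L'.
Proof.
move=> L0 LL; apply/cohomologousP => //.
exists (fun _ _ => 1) => [|a b g x bx ax]; last by rewrite LL// mulr1 mul1r.
by apply/cochain0P => a x _; split; [exact: holC_cst|exact: oner_neq0].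
Qed.

Lemma cohomologous_sym (U : openCover) (L L' : cochain1 G U) :
  (forall a b g x, U b x -> U a (rho g x) -> L a b g x != 0) ->
  (forall a b g x, U b x -> U a (rho g x) -> L' a b g x != 0) ->
  cohomologous rho L L' -> cohomologous rho L' L.
Proof.
move=> L0 L0' /(cohomologousP _ L0)[mu /cochain0P cmu muE].
apply/cohomologousP => //; exists (fun a x => (mu a x)^-1) => [|a b g x bx ax].
  apply/cochain0P => a x /cmu[hmu mu0]; split; last by rewrite invr_eq0.
  exact: holC_inv.
have [_ mua] := cmu a _ ax; have [_ mub] := cmu b _ bx.
by apply/eqP; rewrite [X in _ == X]mulrC eqr_div// mulrC -muE.
Qed.

Lemma cohomologous_trans (U : openCover) (L L' L'' : cochain1 G U) :
  (forall a b g x, U b x -> U a (rho g x) -> L a b g x != 0) ->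
  (forall a b g x, U b x -> U a (rho g x) -> L' a b g x != 0) ->
  cohomologous rho L L' -> cohomologous rho L' L'' -> cohomologous rho L L''.
Proof.
move=> L0 L0' /(cohomologousP _ L0)[mu /cochain0P cmu muE].
move=> /(cohomologousP _ L0')[nu /cochain0P cnu nuE].
apply/cohomologousP => //; exists (fun a x => nu a x * mu a x) => [|a b g x bx ax].
  apply/cochain0P => a x ax; have [hmu mu0] := cmu a x ax; have [hnu nu0] := cnu a x ax.
  by split; [exact: holC_mul|exact: mulf_neq0].
by rewrite mulrA nuE// -mulrA muE// mulrA.
Qed.

Lemma cohomologous_mul (U : openCover) (L1 L1' L2 L2' : cochain1 G U) :
  (forall a b g x, U b x -> U a (rho g x) -> L1 a b g x != 0) ->
  (forall a b g x, U b x -> U a (rho g x) -> L2 a b g x != 0) ->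
  cohomologous rho L1 L1' -> cohomologous rho L2 L2' ->
  cohomologous rho (fun a b g x => L1 a b g x * L2 a b g x)
                   (fun a b g x => L1' a b g x * L2' a b g x).
Proof.
move=> L10 L20 /(cohomologousP _ L10)[mu /cochain0P cmu muE].
move=> /(cohomologousP _ L20)[nu /cochain0P cnu nuE].
apply/cohomologousP => [a b g x bx ax|]; first by rewrite mulf_neq0 ?L10 ?L20.
exists (fun a x => mu a x * nu a x) => [|a b g x bx ax].
  apply/cochain0P => a x ax; have [hmu mu0] := cmu a x ax; have [hnu nu0] := cnu a x ax.
  by split; [exact: holC_mul|exact: mulf_neq0].
by rewrite mulrACA muE// nuE// mulrACA.
Qed.

Lemma cohomologous_pullback (U V : openCover) (r : oc_index V -> oc_index U)
    (L L' : cochain1 G U) : refines r ->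
  cohomologous rho L L' -> cohomologous rho (pullback r L) (pullback r L').
Proof.
move=> rP [mu /cochain0P cmu muE]; exists (fun a => mu (r a)).
  by apply/cochain0P => a x /rP; exact: cmu.
by move=> a b g x /rP bx /rP ax; exact: muE.
Qed.

(** The transition functions between the two choices of indices form the
0-cochain relating the two restrictions. *)
Lemma pullback_cohomologous (U V : openCover) (r s : oc_index V -> oc_index U)
    (L : cochain1 G U) : refines r -> refines s -> is_cocycle rho L ->
  cohomologous rho (pullback r L) (pullback s L).
Proof.
move=> rP sP cL; apply/cohomologousP => [a b g x /rP bx /rP ax|].
  exact: (cocycle_neq0 cL).
exists (fun a => L (s a) (r a) 1%g) => [|a b g x bx ax].
  apply/cochain0P => a x ax; have := rP a x ax; have := sP a x ax => sx rx.
  by split; [exact: (trans_holC cL)|exact: (trans_neq0 cL)].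
have rbx := rP b x bx; have sbx := sP b x bx.
have rax := rP a _ ax; have sax := sP a _ ax.
rewrite /pullback (cocycle_change cL rax sax rbx sbx) -mulrA (transV cL)//.
by rewrite mulr1.
Qed.

Definition capCover (U V : openCover) : openCover.
Proof.
apply: (@OpenCover _ _ M (oc_index U * oc_index V)%type
  (fun i => U i.1 `&` V i.2)).
- by move=> i; apply: openI; exact: oc_open.
- move=> x; have [i ix] := oc_cover U x; have [j jx] := oc_cover V x.
  by exists (i, j).
Defined.

Lemma refines_comp (U V W : openCover) (r : oc_index V -> oc_index U)
    (s : oc_index W -> oc_index V) : refines r -> refines s -> refines (r \o s).
Proof. by move=> rP sP i; apply: subset_trans (sP i) (rP (s i)). Qed.

Lemma refines_fst (U V : openCover) : @refines _ _ M (capCover U V) U fst.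
Proof. by move=> i x []. Qed.

Lemma refines_snd (U V : openCover) : @refines _ _ M (capCover U V) V snd.
Proof. by move=> i x []. Qed.

Lemma pullback_neq0 (U V : openCover) (r : oc_index V -> oc_index U)
    (L : cochain1 G U) : is_cocycle rho L -> refines r ->
  forall a b g x, V b x -> V a (rho g x) -> pullback r L a b g x != 0.
Proof. by move=> cL rP a b g x /rP bx /rP ax; exact: (cocycle_neq0 cL). Qed.

Let neq0P := pullback_neq0.

Lemma coc_equiv_refl (L : cocycle) : coc_equiv L L.
Proof.
have idP : @refines _ _ M (coc_cover L) (coc_cover L) id by move=> i x.
exists (coc_cover L), id, id; split=> //.
by apply: eq_cohomologous => //; exact: (neq0P (coc_cocycle L) idP).
Qed.

Lemma coc_equiv_sym (L L' : cocycle) : coc_equiv L L' -> coc_equiv L' L.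
Proof.
move=> [V [r [r' [rP rP' LL]]]]; exists V, r', r; split=> //.
apply: cohomologous_sym LL; first exact: (neq0P (coc_cocycle L) rP).
exact: (neq0P (coc_cocycle L') rP').
Qed.

(** On the intersection of the two given refinements, the middle cocycle is
restricted along two different maps of indices. *)
Lemma coc_equiv_trans (L L' L'' : cocycle) :
  coc_equiv L L' -> coc_equiv L' L'' -> coc_equiv L L''.
Proof.
move=> [V [r [r' [rP rP' LL]]]] [W [s [s' [sP sP' LL']]]].
have fP := @refines_fst V W; have gP := @refines_snd V W.
exists (capCover V W), (r \o fst), (s' \o snd); split.
- exact: refines_comp.
- exact: refines_comp.
have rfP := refines_comp rP fP; have rfP' := refines_comp rP' fP.
have sgP := refines_comp sP gP; have sgP' := refines_comp sP' gP.
apply: (@cohomologous_trans (capCover V W) _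
  (@pullback _ _ _ _ G M (capCover V W) _ (r' \o fst) (cofun L'))).
- exact: (neq0P (coc_cocycle L) rfP).
- exact: (neq0P (coc_cocycle L') rfP').
- exact: (cohomologous_pullback fP LL).
apply: (@cohomologous_trans (capCover V W) _
  (@pullback _ _ _ _ G M (capCover V W) _ (s \o snd) (cofun L'))).
- exact: (neq0P (coc_cocycle L') rfP').
- exact: (neq0P (coc_cocycle L') sgP).
- exact: (pullback_cohomologous rfP' sgP (coc_cocycle L')).
exact: (cohomologous_pullback gP LL').
Qed.

Lemma cocycle_pullback (U V : openCover) (r : oc_index V -> oc_index U)
    (L : cochain1 G U) : refines r -> is_cocycle rho L ->
  is_cocycle rho (pullback r L).
Proof.
move=> rP cL; apply/cocycleP; split=> [a b g x /rP bx /rP ax|].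
  by split; [exact: (cocycle_regC cL)|exact: (cocycle_holC cL)|exact: (cocycle_neq0 cL)].
by move=> a b c g h x /rP cx /rP bx /rP ax; exact: (cocycleM cL).
Qed.

Lemma cocycle_mul (U : openCover) (L L' : cochain1 G U) :
  is_cocycle rho L -> is_cocycle rho L' ->
  is_cocycle rho (fun a b g x => L a b g x * L' a b g x).
Proof.
move=> cL cL'; apply/cocycleP; split=> [a b g x bx ax|].
  split.
  - by apply: regC_mul; [exact: (cocycle_regC cL)|exact: (cocycle_regC cL')].
  - by apply: holC_mul; [exact: (cocycle_holC cL)|exact: (cocycle_holC cL')].
  - by apply: mulf_neq0; [exact: (cocycle_neq0 cL)|exact: (cocycle_neq0 cL')].
move=> a b c g h x cx bx ax.
by rewrite (cocycleM cL cx bx ax) (cocycleM cL' cx bx ax) mulrACA.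
Qed.

Lemma cocycle_inv (U : openCover) (L : cochain1 G U) :
  is_cocycle rho L -> is_cocycle rho (fun a b g x => (L a b g x)^-1).
Proof.
move=> cL; apply/cocycleP; split=> [a b g x bx ax|].
  have L0 := cocycle_neq0 cL bx ax; split; last by rewrite invr_eq0.
    by apply: (@regC_inv _ _ _ _ _ _ (fun p => L a b p.1 p.2)) => //;
      exact: (cocycle_regC cL).
  by apply: holC_inv => //; exact: (cocycle_holC cL).
by move=> a b c g h x cx bx ax; rewrite (cocycleM cL cx bx ax) invfM.
Qed.

Definition coc_mul (L L' : cocycle) : cocycle :=
  Cocycle (cocycle_mul
    (cocycle_pullback (@refines_fst (coc_cover L) (coc_cover L')) (coc_cocycle L))
    (cocycle_pullback (@refines_snd (coc_cover L) (coc_cover L')) (coc_cocycle L'))).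

Definition coc_inv (L : cocycle) : cocycle := Cocycle (cocycle_inv (coc_cocycle L)).

Definition totalCover : openCover.
Proof.
apply: (@OpenCover _ _ M unit (fun _ => setT)); first by move=> _; exact: openT.
by move=> x; exists tt.
Defined.

Lemma cocycle_one : is_cocycle rho ((fun _ _ _ _ => 1) : cochain1 G totalCover).
Proof.
apply/cocycleP; split=> [a b g x _ _|a b c g h x _ _ _]; last by rewrite mulr1.
by split; [exact: regC_cst|exact: holC_cst|exact: oner_neq0].
Qed.

Definition coc_one : cocycle := Cocycle cocycle_one.

Lemma eq_coc_equiv (L L' : cocycle) (V : openCover)
    (r : oc_index V -> oc_index (coc_cover L))
    (r' : oc_index V -> oc_index (coc_cover L')) :
  refines r -> refines r' ->
  (forall a b g x, V b x -> V a (rho g x) ->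
     cofun L' (r' a) (r' b) g x = cofun L (r a) (r b) g x) ->
  coc_equiv L L'.
Proof.
move=> rP rP' LL; exists V, r, r'; split=> //; apply: eq_cohomologous => //.
exact: (neq0P (coc_cocycle L)).
Qed.

Lemma coc_productP (L L' L'' : cocycle) :
  is_coc_product L L' L'' <-> coc_equiv (coc_mul L L') L''.
Proof.
split=> [[V [r [r' [r'' [rP rP' rP'' LL]]]]]|[V [r [r' [rP rP' LL]]]]].
  exists V, (fun i => (r i, r' i)), r''; split=> //.
  by move=> i x ix; split; [exact: rP|exact: rP'].
exists V, (fst \o r), (snd \o r), r'; split=> //.
  exact: (refines_comp (@refines_fst _ _) rP).
exact: (refines_comp (@refines_snd _ _) rP).
Qed.

Lemma coc_mul_equiv (L L' N N' : cocycle) :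
  coc_equiv L L' -> coc_equiv N N' -> coc_equiv (coc_mul L N) (coc_mul L' N').
Proof.
move=> [V [r [r' [rP rP' LL]]]] [W [s [s' [sP sP' NN]]]].
have fP := @refines_fst V W; have gP := @refines_snd V W.
exists (capCover V W), (fun i => (r i.1, s i.2)), (fun i => (r' i.1, s' i.2)); split.
- by move=> i x [ix jx]; split; [exact: rP|exact: sP].
- by move=> i x [ix jx]; split; [exact: rP'|exact: sP'].
apply: (cohomologous_mul _ _ (cohomologous_pullback fP LL) (cohomologous_pullback gP NN)).
  exact: (neq0P (coc_cocycle L) (refines_comp rP fP)).
exact: (neq0P (coc_cocycle N) (refines_comp sP gP)).
Qed.

Lemma coc_mulA (L L' L'' : cocycle) :
  coc_equiv (coc_mul L (coc_mul L' L'')) (coc_mul (coc_mul L L') L'').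
Proof.
apply: (@eq_coc_equiv (coc_mul L (coc_mul L' L'')) (coc_mul (coc_mul L L') L'')
  (coc_cover (coc_mul L (coc_mul L' L''))) id
  (fun i => ((i.1, i.2.1), i.2.2))).
- by move=> i x.
- by move=> i x [? [? ?]]; split.
- by move=> a b g x _ _; rewrite /= /pullback /= mulrA.
Qed.

Lemma coc_mulC (L L' : cocycle) : coc_equiv (coc_mul L L') (coc_mul L' L).
Proof.
apply: (@eq_coc_equiv (coc_mul L L') (coc_mul L' L) (coc_cover (coc_mul L L')) id
  (fun i => (i.2, i.1))).
- by move=> i x.
- by move=> i x []; split.
- by move=> a b g x _ _; rewrite /= /pullback /= mulrC.
Qed.

Lemma coc_mul1 (L : cocycle) : coc_equiv (coc_mul coc_one L) L.
Proof.
apply: (@eq_coc_equiv (coc_mul coc_one L) L (coc_cover L) (fun i => (tt, i)) id).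
- by move=> i x ix; exact: (conj Logic.I ix).
- by move=> i x.
- by move=> a b g x _ _; rewrite /= /pullback /= mul1r.
Qed.

Lemma coc_mulV (L : cocycle) : coc_equiv (coc_mul (coc_inv L) L) coc_one.
Proof.
apply: (@eq_coc_equiv (coc_mul (coc_inv L) L) coc_one (coc_cover L)
  (fun i => (i, i)) (fun=> tt)).
- by move=> i x ix; exact: (conj ix ix).
- by move=> i x.
- move=> a b g x bx ax; rewrite /= /pullback /= mulVf//.
  exact: (cocycle_neq0 (coc_cocycle L)).
Qed.

(** Covers have arbitrary index types, but each cocycle is equivalent to one
whose cover is indexed by the points of [M]; such data stay in the universe of
[M]. *)
Definition coc_data := ((M -> set M) * (M -> M -> G -> M -> C))%type.

(** Selecting, at each point, a member of the cover that contains it restricts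
the cocycle to a cover indexed by [M]. *)
Definition coc_presents (d : coc_data) (L : cocycle) : Prop :=
  exists2 r : M -> oc_index (coc_cover L), (forall x, coc_cover L (r x) x) &
    d = (fun x => coc_cover L (r x), fun a b => cofun L (r a) (r b)).

Lemma coc_presents_exists L : exists d, coc_presents d L.
Proof.
have [r rP] := choice (oc_cover (coc_cover L)).
by exists (fun x => coc_cover L (r x), fun a b => cofun L (r a) (r b)), r.
Qed.

Lemma coc_presents_equiv d L L' :
  coc_presents d L -> coc_presents d L' -> coc_equiv L L'.
Proof.
move=> [r rP ->] [r' rP' [UE LE]].
pose V : openCover := @OpenCover _ _ M M (fun x => coc_cover L (r x))
  (fun x => oc_open (r x)) (fun x => ex_intro (fun i => coc_cover L (r i) x) x (rP x)).
apply: (@eq_coc_equiv _ _ V r r').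
- by move=> i x.
- move=> i x; rewrite /= -/(_ i).
  by have /= <- := congr1 (fun f => f i) UE.
- move=> a b g x _ _.
  by have /= <- := congr1 (fun f => f a b g x) LE.
Qed.

(** A complete invariant of the class of a cocycle. *)
Definition coc_class (L : cocycle) : set coc_data :=
  [set d | exists2 L', coc_equiv L L' & coc_presents d L'].

Lemma coc_classE L L' : coc_class L = coc_class L' <-> coc_equiv L L'.
Proof.
split=> [LL|LL].
  have [d dL] := coc_presents_exists L.
  have : coc_class L d by exists L => //; exact: coc_equiv_refl.
  rewrite LL => -[N LN dN].
  apply: coc_equiv_trans (coc_presents_equiv dL dN) _; exact: coc_equiv_sym.
apply/seteqP; split=> d [N LN dN]; exists N => //.
  exact: coc_equiv_trans (coc_equiv_sym LL) LN.
exact: coc_equiv_trans LL LN.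
Qed.

Lemma H1Group_exists : inhabited (H1Group rho).
Proof.
exact: (classGroup_quotient coc_classE coc_productP coc_mul_equiv coc_mulA coc_mulC
  coc_mul1 coc_mulV).
Qed.

End CohomologyGroup.

(** * Framings of line bundles *)

Section Framings.
Variables (R : realType) (n : nat) (M : complexManifold R n).
Local Notation C := (Cfield R).
Local Notation C1 := (line_charted (Cfield R)).
Local Notation MC := (prod_charted M C1).
Local Notation hol := (@holomorphic_on R).

Let holP := holomorphic_is_regularity R.
Let aM : is_atlas hol M := cm_atlas M.
Let aC1 : is_atlas hol C1 := line_is_atlas holP.
Let aMC : is_atlas hol MC := prod_is_atlas holP aM aC1.

Definition is_trivialization (E : lineBundle M) (U : set M) (t : E -> M * C)
    (s : M * C -> E) : Prop :=
  [/\ holo (Y := MC) (lb_proj (l := E) @^-1` U) t /\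
        holo (X := MC) (U `*` setT) s,
      forall e, U (lb_proj e) -> (t e).1 = lb_proj e /\ s (t e) = e,
      forall p, U p.1 -> lb_proj (s p) = p.1 /\ t (s p) = p &
      forall y, U y -> linear (fun u : lb_fiber E y => (t (lb_incl u)).2 : C^o)].

(** Local trivialisations over the members of a cover. The sections
[fun x => fr_s a (x, 1)] are the frames: nonvanishing holomorphic sections over
[U a]. *)
Record framing (E : lineBundle M) (U : openCover M) := Framing {
  fr_t : oc_index U -> E -> M * C;
  fr_s : oc_index U -> M * C -> E;
  fr_trivialization : forall a, is_trivialization (U a) (fr_t a) (fr_s a) }.

Section Bundle.
Variable E : lineBundle M.
Let aE : is_atlas hol E := cm_atlas E.

Lemma lb_proj_continuous : continuous (lb_proj (l := E)).
Proof. by move=> e; exact: (lb_proj_holo E).1. Qed.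

Lemma lb_proj_regular_at e : regular_at (X := E) (Y := M) hol (lb_proj (l := E)) e.
Proof. exact: (regular_onP holP aE aM _ openT).1 (lb_proj_holo E) e Logic.I. Qed.

Lemma lb_proj_open U : open U -> open (lb_proj (l := E) @^-1` U).
Proof. by apply: open_comp => e _; exact: lb_proj_continuous. Qed.

Lemma proj_incl x (u : lb_fiber E x) : lb_proj (lb_incl u) = x.
Proof.
have : range (@lb_incl _ _ _ E x) (lb_incl u) by exists u.
by rewrite lb_incl_range.
Qed.

Lemma incl_surj x (e : E) : lb_proj e = x -> exists u : lb_fiber E x, lb_incl u = e.
Proof.
move=> ex; have : (lb_proj (l := E) @^-1` [set x]) e by [].
by rewrite -lb_incl_range => -[u _ <-]; exists u.
Qed.

Lemma framing_exists : exists U : openCover M, inhabited (framing E U).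
Proof.
have /choice[f fP] : forall x : M, exists w : set M * ((E -> M * C) * (M * C -> E)),
    [/\ open w.1, w.1 x & is_trivialization w.1 w.2.1 w.2.2].
  by move=> x; have [U [t [s [[oU Ux] ? ? ? ?]]]] := lb_trivial E x; exists (U, (t, s)).
pose U : openCover M := @OpenCover _ _ M M (fun x => (f x).1)
  (fun x => let: And3 o _ _ := fP x in o)
  (fun x => ex_intro (fun i => (f i).1 x) x (let: And3 _ o _ := fP x in o)).
exists U; constructor.
by apply: (@Framing _ U (fun x => (f x).2.1) (fun x => (f x).2.2)) => x; case: (fP x).
Qed.

Section Theory.
Variables (U : openCover M) (F : framing E U).

Definition fcoord a (e : E) : C := (fr_t F a e).2.
Definition sec a x (z : C) : E := fr_s F a (x, z).

Lemma sec_fcoord a e : U a (lb_proj e) -> sec a (lb_proj e) (fcoord a e) = e.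
Proof.
move=> ae; have [_ ts _ _] := fr_trivialization F a; have [t1 se] := ts e ae.
by rewrite /sec /fcoord -t1 -surjective_pairing.
Qed.

Lemma proj_sec a x z : U a x -> lb_proj (sec a x z) = x.
Proof. by move=> ax; have [_ _ st _] := fr_trivialization F a; case: (st (x, z) ax). Qed.

Lemma fcoord_sec a x z : U a x -> fcoord a (sec a x z) = z.
Proof.
move=> ax; have [_ _ st _] := fr_trivialization F a.
by rewrite /fcoord /sec; have [_ ->] := st (x, z) ax.
Qed.

Lemma fcoord_linear a x : U a x ->
  linear (fun u : lb_fiber E x => fcoord a (lb_incl u) : C^o).
Proof. by move=> ax; have [_ _ _] := fr_trivialization F a; exact. Qed.

Lemma fcoordP a x (z : C) (u v : lb_fiber E x) : U a x ->
  fcoord a (lb_incl (z *: u + v)) = z * fcoord a (lb_incl u) + fcoord a (lb_incl v).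
Proof. by move=> ax; exact: fcoord_linear. Qed.

Lemma fcoordZ a x (z : C) (u : lb_fiber E x) : U a x ->
  fcoord a (lb_incl (z *: u)) = z * fcoord a (lb_incl u).
Proof.
move=> ax; have l := fcoord_linear ax.
have l0 : fcoord a (lb_incl (0 : lb_fiber E x)) = 0.
  by have := l (-1) 0 0; rewrite scaler0 addr0 scaleN1r addNr.
by have := l z u 0; rewrite !addr0 l0 addr0.
Qed.

Lemma fcoord_inj a e e' : U a (lb_proj e) -> lb_proj e = lb_proj e' ->
  fcoord a e = fcoord a e' -> e = e'.
Proof. by move=> ae ee' ce; rewrite -(sec_fcoord ae) ce ee' sec_fcoord// -ee'. Qed.

Lemma secE a x z e : U a x -> lb_proj e = x -> fcoord a e = z -> e = sec a x z.
Proof. by move=> + ex; rewrite -ex => ae <-; rewrite sec_fcoord. Qed.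

Lemma fcoord_regular_at a e : U a (lb_proj e) ->
  regular_at (X := E) (Y := C1) hol (fcoord a) e.
Proof.
move=> ae; have [[ht _] _ _ _] := fr_trivialization F a.
have oU := lb_proj_open (oc_open a).
have := (regular_onP holP aE aMC _ oU).1 ht e ae => rt.
exact: (regular_at_comp holP aE aMC rt (regular_at_snd (X := M) holP aC1 _)).
Qed.

Lemma sec_regular_at a p : U a p.1 ->
  regular_at (X := MC) (Y := E) hol (fun q => sec a q.1 q.2) p.
Proof.
move=> ap; have [[_ hs] _ _ _] := fr_trivialization F a.
have oU : open (U a `*` [set: C]) by apply: openX; [exact: oc_open|exact: openT].
have := (regular_onP holP aMC aE _ oU).1 hs p (conj ap Logic.I) => rs.
have -> // : (fun q => sec a q.1 q.2) = fr_s F a.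
by apply/funext => -[x z].
Qed.

Lemma sec_regular_along m (X : charted C m) a (h : X -> M) (f : X -> C) x :
  is_atlas hol X -> U a (h x) ->
  regular_at (Y := M) hol h x -> regular_at (Y := C1) hol f x ->
  regular_at (Y := E) hol (fun y => sec a (h y) (f y)) x.
Proof.
move=> aX ax rh rf.
exact: (regular_at_comp holP aX aMC (regular_at_pair holP rh rf)
  (sec_regular_at (p := (h x, f x)) ax)).
Qed.

Lemma frame_regular_at a x : U a x ->
  regular_at (X := M) (Y := E) hol (fun y => sec a y 1) x.
Proof.
move=> ax; exact: (sec_regular_along (h := fun y => y) (f := fun=> 1) aM ax
  (regular_at_id _ aM) (regular_at_cst holP _ _)).
Qed.

(** The frame as a vector of the fibre; the default 0 can only occur outside
[U a]. *)
Definition vec a x : lb_fiber E x := xget 0 [set u | lb_incl u = sec a x 1].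

Lemma incl_vec a x : U a x -> lb_incl (vec a x) = sec a x 1.
Proof.
move=> ax; apply: (@xgetPex _ (0 : lb_fiber E x) [set u | lb_incl u = sec a x 1]).
exact: incl_surj (proj_sec 1 ax).
Qed.

Lemma vec_fcoord a x (u : lb_fiber E x) : U a x -> u = fcoord a (lb_incl u) *: vec a x.
Proof.
move=> ax; apply: lb_incl_inj; apply: (@fcoord_inj a); rewrite ?proj_incl//.
by rewrite fcoordZ// incl_vec// fcoord_sec// mulr1.
Qed.

Lemma incl_vecZ a x z : U a x -> lb_incl (z *: vec a x) = sec a x z.
Proof.
move=> ax; apply: (secE ax); first exact: proj_incl.
by rewrite fcoordZ// incl_vec// fcoord_sec// mulr1.
Qed.

End Theory.

Definition framing_pullback (U V : openCover M) (r : oc_index V -> oc_index U)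
    (rP : refines r) (F : framing E U) : framing E V.
Proof.
apply: (@Framing E V (fun a => fr_t F (r a)) (fun a => fr_s F (r a))) => a.
have [[ht hs] ts st tl] := fr_trivialization F (r a); split.
- split.
    apply/(regular_onP holP aE aMC _ (lb_proj_open (oc_open a))) => e ae.
    exact: (regular_onP holP aE aMC _ (lb_proj_open (oc_open (r a)))).1 ht e (rP _ _ ae).
  have oX (W : openCover M) b : open (W b `*` [set: C]).
    by apply: openX; [exact: oc_open|exact: openT].
  apply/(regular_onP holP aMC aE _ (oX _ _)) => p [ap _].
  exact: (regular_onP holP aMC aE _ (oX _ _)).1 hs p (conj (rP _ _ ap) Logic.I).
- by move=> e /rP; exact: ts.
- by move=> p /rP; exact: st.
- by move=> y /rP; exact: tl.
Defined.

End Bundle.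

(** [sec FE b x z] is [z] times [sec FE b x 1] in the line [lb_fiber E x], on
which [f] is linear; this is how linearity on the fibres is used from here
on. *)
Lemma fiberwise_linear_sec (E F : lineBundle M) (U V : openCover M)
    (FE : framing E U) (FF : framing F V) (h : M -> M) (f : E -> F) a b x z :
  fiberwise_linear h f -> U b x -> V a (h x) ->
  f (sec FE b x z) = sec FF a (h x) (fcoord FF a (f (sec FE b x 1)) * z).
Proof.
move=> fl bx ax; have [A fA] := fl x.
apply: (secE ax).
  by have [u <-] := incl_surj (proj_sec FE z bx); rewrite fA proj_incl.
rewrite -(incl_vecZ FE z bx) -(incl_vec FE bx) !fA linearZ.
by rewrite fcoordZ// mulrC.
Qed.

(** Conversely, a map that multiplies coordinates by a constant on each fibre is
linear there. *)
Lemma fiberwise_linear_fcoord (E F : lineBundle M) (U V : openCover M)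
    (FE : framing E U) (FF : framing F V) (h : M -> M) (f : E -> F) :
  (forall x, exists a b c, [/\ U b x, V a (h x) &
    forall e, lb_proj e = x -> f e = sec FF a (h x) (c * fcoord FE b e)]) ->
  fiberwise_linear h f.
Proof.
move=> H x; have [a [b [c [bx ax fE]]]] := H x.
pose A (u : lb_fiber E x) : lb_fiber F (h x) := (c * fcoord FE b (lb_incl u)) *: vec FF a (h x).
have lA : linear A.
  move=> z u v; rewrite /A fcoordP// scalerA -scalerDl.
  by congr (_ *: _); rewrite mulrDr mulrCA.
exists (HB.pack_for {linear lb_fiber E x -> lb_fiber F (h x)} A
  (GRing.isLinear.Build C (lb_fiber E x) (lb_fiber F (h x)) _ A lA)) => u /=.
by rewrite /A incl_vecZ// fE// proj_incl.
Qed.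

End Framings.

(** * The cocycle of a framed equivariant bundle *)

Section EquivariantFramings.
Variables (R : realType) (k : lie_kind) (m n : nat).
Variables (G : lieGroup R k m) (M : complexManifold R n) (rho : action G M).
Local Notation C := (Cfield R).
Local Notation C1 := (line_charted (Cfield R)).
Local Notation MC := (prod_charted M C1).
Local Notation hol := (@holomorphic_on R).
Local Notation rk := (@lie_reg R k).
Local Notation GX X := (prod_charted (lg_charted G) (underlying k X)).
Local Notation bundle := (equivariantLineBundle rho).
Local Notation lift := Defs.lift.

Let holP := holomorphic_is_regularity R.
Let rkP := lie_reg_is_regularity R k.
Let aM : is_atlas hol M := cm_atlas M.
Let aC1 : is_atlas hol C1 := line_is_atlas holP.
Let aG : is_atlas rk (lg_charted G) := manifold_atlas rkP (lg_manifold G).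
Let aU N (X : charted C N) (aX : is_atlas hol X) : is_atlas rk (underlying k X) :=
  underlying_is_atlas k aX.
Let aGX N (X : charted C N) (aX : is_atlas hol X) : is_atlas rk (GX X) :=
  prod_is_atlas rkP aG (aU aX).

Section Transition.
Variables (E : bundle) (U : openCover M) (F : framing E U).
Let aE : is_atlas hol E := cm_atlas E.

(** [lift g] sends the frame of index [b] at [x] to this multiple of the frame of
index [a] at [rho g x]. *)
Definition lift_cocycle : cochain1 G U :=
  fun a b g x => fcoord F a (lift g (sec F b x 1)).

Lemma lift_sec a b g x z : U b x -> U a (rho g x) ->
  lift g (sec F b x z) = sec F a (rho g x) (lift_cocycle a b g x * z).
Proof. by move=> bx ax; apply: fiberwise_linear_sec => //; exact: lift_linear. Qed.

Lemma lift_fcoord a b g e : U b (lb_proj e) -> U a (rho g (lb_proj e)) ->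
  fcoord F a (lift g e) = lift_cocycle a b g (lb_proj e) * fcoord F b e.
Proof. by move=> be ae; rewrite -{1}(sec_fcoord F be) (lift_sec _ be ae) fcoord_sec. Qed.

Lemma lift_holo_at g e : regular_at (X := E) (Y := E) hol (lift g) e.
Proof. exact: (regular_onP holP aE aE _ openT).1 (lift_holo E g) e Logic.I. Qed.

Lemma lift_regular_at p :
  regular_at (X := GX E) (Y := underlying k E) rk
    (fun p : G * E => lift p.1 p.2 : E) p.
Proof.
exact: (regular_onP rkP (aGX aE) (aU aE) _ openT).1 (lift_regular E) p Logic.I.
Qed.

(** The cocycle identity is [liftM] read in the frames. It also implies that the
functions do not vanish, since [lift g^-1] inverts [lift g]; they are regular as
composites of the frames, the lifted action and the coordinates. *)
Lemma lift_cocycle_is_cocycle : is_cocycle rho lift_cocycle.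
Proof.
have TM a b c g h x : U c x -> U b (rho h x) -> U a (rho g (rho h x)) ->
    lift_cocycle a c (g * h)%g x = lift_cocycle a b g (rho h x) * lift_cocycle b c h x.
  move=> cx bx ax; rewrite {1}/lift_cocycle liftM (lift_sec _ cx bx) (lift_sec _ bx ax).
  by rewrite fcoord_sec// mulr1.
have T1 a x : U a x -> lift_cocycle a a 1%g x = 1 by move=> ax; rewrite /lift_cocycle lift1 fcoord_sec.
apply/cocycleP; split; last exact: TM.
move=> a b g x bx ax.
have sb : regular_at (X := M) (Y := E) hol (fun y => sec F b y 1) x.
  exact: frame_regular_at.
have ae : U a (lb_proj (lift g (sec F b x 1))) by rewrite lift_proj proj_sec.
split.
- have r1 : regular_at (X := GX M) (Y := underlying k E) rk
      (fun p : G * M => sec F b p.2 1) (g, x).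
    exact: (regular_at_comp rkP (aGX aM) (aU aM)
      (regular_at_snd (X := lg_charted G) rkP (aU aM) (g, x))
      (underlying_regular_at k sb)).
  have r2 : regular_at (X := GX M) (Y := GX E) rk
      (fun p : G * M => (p.1, sec F b p.2 1)) (g, x).
    apply: (regular_at_pair rkP _ r1).
    exact: (regular_at_fst (Y := underlying k M) rkP aG (g, x)).
  have r3 := regular_at_comp rkP (aGX aM) (aGX aE) r2 (lift_regular_at _).
  exact: (regular_at_comp rkP (aGX aM) (aU aE) r3
    (underlying_regular_at k (fcoord_regular_at F ae))).
- have r1 := regular_at_comp holP aM aE sb (lift_holo_at g _).
  exact: (regular_at_comp holP aM aE r1 (fcoord_regular_at F ae)).
- have := TM b a b g^-1%g g x bx ax; rewrite actK => /(_ bx).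
  rewrite mulVg T1// => T; apply/eqP => T0; move: T; rewrite T0 mulr0.
  by move/eqP; rewrite oner_eq0.
Qed.

End Transition.

(** Over [U a], let [f] send the frame of [E] to [mu a] times that of [F]. The
hypothesis on [mu], which is the cohomology relation for the neutral element of
[G], says that these local maps agree on intersections. *)
Lemma glue_map (E F : bundle) (U : openCover M) (FE : framing E U) (FF : framing F U)
    (mu : cochain0 U) : is_cochain0 mu ->
  (forall a b x, U a x -> U b x ->
    lift_cocycle FF a b 1%g x * mu b x = mu a x * lift_cocycle FE a b 1%g x) ->
  exists f : E -> F,
    [/\ forall a e, U a (lb_proj e) ->
          f e = sec FF a (lb_proj e) (mu a (lb_proj e) * fcoord FE a e),
        holo setT f & fiberwise_linear id f].
Proof.
move=> /cochain0P cmu muT; have [i iP] := choice (oc_cover U).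
pose f (e : E) : F := let x := lb_proj e in sec FF (i x) x (mu (i x) x * fcoord FE (i x) e).
have fE a e : U a (lb_proj e) ->
    f e = sec FF a (lb_proj e) (mu a (lb_proj e) * fcoord FE a e).
  move=> ae; rewrite /f; set x := lb_proj e.
  have ax1 : U a (rho 1%g x) by rewrite act1.
  have ax : U a x := ae.
  apply: (secE ax); first by rewrite proj_sec//; exact: iP.
  have := lift_sec FF (mu (i x) x * fcoord FE (i x) e) (iP x) ax1.
  rewrite lift1 act1 => ->; rewrite fcoord_sec// mulrA muT// -mulrA; congr (_ * _).
  by rewrite -[RHS](congr1 (fcoord FE a) (lift1 e)) (lift_fcoord FE (iP x) ax1).
have aE := cm_atlas E; have aF := cm_atlas F.
exists f; split=> //.
  apply/(regular_onP holP aE aF _ openT) => e _.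
  have [a ae] := oc_cover U (lb_proj e).
  have oa := lb_proj_open E (oc_open a).
  apply: (regular_at_congr holP aE
    (f := fun e => sec FF a (lb_proj e) (mu a (lb_proj e) * fcoord FE a e))).
    by apply: (near_open oa ae) => y ay; rewrite (fE a).
  have rmu : regular_at (X := E) (Y := C1) hol (fun y => mu a (lb_proj y)) e.
    have [hmu _] := cmu a _ ae.
    exact: (regular_at_comp holP aE aM (lb_proj_regular_at e) hmu).
  have rm := regular_at_comp holP aE (prod_is_atlas holP aC1 aC1)
    (regular_at_pair holP rmu (fcoord_regular_at FE ae)) (regular_at_mul _).
  exact: (sec_regular_along FF aE ae (lb_proj_regular_at e) rm).
apply: (fiberwise_linear_fcoord (FE := FE) (FF := FF)) => x.
exists (i x), (i x), (mu (i x) x); split; [exact: iP|exact: iP|].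
by move=> e ex; rewrite (fE (i x)) ex//; exact: iP.
Qed.

(** An isomorphism amounts to the nonvanishing functions that express the images
of the frames of [E] in those of [F]; it commutes with [G] exactly when these
functions form a 0-cochain relating the two cocycles. *)
Lemma equiv_cohomologous (E F : bundle) (U : openCover M)
    (FE : framing E U) (FF : framing F U) :
  elb_equiv E F <-> cohomologous rho (lift_cocycle FE) (lift_cocycle FF).
Proof.
have aE := cm_atlas E; have aF := cm_atlas F.
have TE0 a b g x := @cocycle_neq0 _ _ _ _ _ _ _ _ _ (lift_cocycle_is_cocycle FE) a b g x.
split=> [[f [f' [[fK f'K] [hf hf'] fl fG]]]|/(cohomologousP _ TE0)[mu cmu muE]].
  apply/cohomologousP => //; exists (fun a x => fcoord FF a (f (sec FE a x 1))).
    apply/cochain0P => a x ax.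
    have fx : U a (lb_proj (f (sec FE a x 1))).
      by rewrite (fiberwise_linear_sec FE FF (a := a) 1 fl ax ax) proj_sec.
    split.
      have sa : regular_at (X := M) (Y := E) hol (fun y => sec FE a y 1) x.
        exact: frame_regular_at.
      have rf := (regular_onP holP aE aF _ openT).1 hf (sec FE a x 1) Logic.I.
      exact: (regular_at_comp holP aM aF (regular_at_comp holP aM aE sa rf)
        (fcoord_regular_at FF fx)).
    apply/eqP => f0.
    have E1 := fiberwise_linear_sec FE FF (a := a) 1 fl ax ax.
    have E0 := fiberwise_linear_sec FE FF (a := a) 0 fl ax ax.
    have /(can_inj fK)/(congr1 (fcoord FE a)) : f (sec FE a x 1) = f (sec FE a x 0).
      by rewrite E0 E1 f0 mulr0 mul0r.
    by rewrite !fcoord_sec// => /eqP; rewrite oner_eq0.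
  move=> a b g x bx ax.
  have := fG g (sec FE b x 1).
  rewrite (lift_sec FE 1 bx ax) (fiberwise_linear_sec FE FF (a := a) _ fl ax ax).
  rewrite (fiberwise_linear_sec FE FF (a := b) 1 fl bx bx).
  rewrite (lift_sec FF _ bx ax) => /(congr1 (fcoord FF a)).
  by rewrite !fcoord_sec// !mulr1 => ->.
have TF0 a b g x := @cocycle_neq0 _ _ _ _ _ _ _ _ _ (lift_cocycle_is_cocycle FF) a b g x.
have mu0 a x : U a x -> mu a x != 0 by case/((cochain0P mu).1 cmu a).
have muT a b x : U a x -> U b x ->
    lift_cocycle FF a b 1%g x * mu b x = mu a x * lift_cocycle FE a b 1%g x.
  by move=> ax bx; have := muE a b 1%g x bx; rewrite act1; exact.
have cmuV : is_cochain0 (fun a x => (mu a x)^-1).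
  apply/cochain0P => a x ax; have [hmu _] := (cochain0P mu).1 cmu a x ax.
  by split; [exact: holC_inv (mu0 _ _ ax) hmu|rewrite invr_eq0 mu0].
have [f [fE hf fl]] := glue_map cmu muT.
have [|f' [f'E hf' _]] := @glue_map F E U FF FE _ cmuV.
  move=> a b x ax bx; have m0 := mu0 a x ax; have m0' := mu0 b x bx.
  apply: (mulfI m0); apply: (mulIf m0'); rewrite mulrA -mulrA mulVf// mulr1.
  by rewrite -muT// mulrA mulfV// mul1r.
have pf e : lb_proj (f e) = lb_proj e.
  by have [a ae] := oc_cover U (lb_proj e); rewrite (fE a)// proj_sec.
have pf' e : lb_proj (f' e) = lb_proj e.
  by have [a ae] := oc_cover U (lb_proj e); rewrite (f'E a)// proj_sec.
exists f, f'; split=> //.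
  split=> e; have [a ae] := oc_cover U (lb_proj e).
    have ae' : U a (lb_proj (f e)) by rewrite pf.
    rewrite (f'E a)// pf (fE a)// fcoord_sec// mulrA mulVf ?mu0// mul1r.
    exact: sec_fcoord.
  have ae' : U a (lb_proj (f' e)) by rewrite pf'.
  rewrite (fE a)// pf' (f'E a)// fcoord_sec// mulrA mulfV ?mu0// mul1r.
  exact: sec_fcoord.
move=> g e; have [b be] := oc_cover U (lb_proj e).
have [a ae] := oc_cover U (rho g (lb_proj e)).
have ale : U a (lb_proj (lift g e)) by rewrite lift_proj.
rewrite (fE a)// lift_proj (fE b)// (lift_sec _ _ be ae) (lift_fcoord FE be ae).
by rewrite !mulrA muE.
Qed.

End EquivariantFramings.

(** * Tensor products and products of cocycles *)

Section Tensor.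
Variables (R : realType) (k : lie_kind) (m n : nat).
Variables (G : lieGroup R k m) (M : complexManifold R n) (rho : action G M).
Local Notation C := (Cfield R).
Local Notation C1 := (line_charted (Cfield R)).
Local Notation hol := (@holomorphic_on R).
Local Notation bundle := (equivariantLineBundle rho).
Local Notation lift := Defs.lift.

Let holP := holomorphic_is_regularity R.
Let aM : is_atlas hol M := cm_atlas M.

Variables (E F L : bundle) (U : openCover M).
Variables (FE : framing E U) (FF : framing F U) (FL : framing L U).
Local Notation TE := (lift_cocycle FE).
Local Notation TF := (lift_cocycle FF).
Local Notation TL := (lift_cocycle FL).
Local Notation TEF := (fun a b g x => TE a b g x * TF a b g x).

Let TEF0 a b g x : U b x -> U a (rho g x) -> TEF a b g x != 0.
Proof.
move=> bx ax; apply: mulf_neq0; apply: cocycle_neq0 bx ax; exact: lift_cocycle_is_cocycle.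
Qed.

Section Line.
Variables (x : M) (a : oc_index U) (ax : U a x).

(** The fibres are lines, spanned by the frames. *)
Lemma bilinear_frame (Z : lmodType C) (c : lb_fiber E x -> lb_fiber F x -> Z) u v :
  is_bilinear c ->
  c u v = (fcoord FE a (lb_incl u) * fcoord FF a (lb_incl v)) *:
            c (vec FE a x) (vec FF a x).
Proof.
move=> [cl cr].
have cZr w z v' : c w (z *: v') = z *: c w v'.
  have c0 : c w 0 = 0 by have := cl w (-1) 0 0; rewrite scaler0 addr0 scaleN1r addNr.
  by have := cl w z v' 0; rewrite !addr0 c0 addr0.
have cZl w z v' : c (z *: w) v' = z *: c w v'.
  have c0 : c 0 v' = 0 by have := cr v' (-1) 0 0; rewrite /= scaler0 addr0 scaleN1r addNr.
  by have := cr v' z w 0; rewrite /= !addr0 c0 addr0.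
by rewrite {1}(vec_fcoord FE u ax) {1}(vec_fcoord FF v ax) cZl cZr scalerA.
Qed.

Lemma coord_bilinear (z : C) (Z : lmodType C) (w : Z) :
  is_bilinear (fun (u : lb_fiber E x) (v : lb_fiber F x) =>
    (z * (fcoord FE a (lb_incl u) * fcoord FF a (lb_incl v))) *: w).
Proof.
split=> [u|v] s y y'; rewrite /= fcoordP// scalerA -scalerDl; congr (_ *: _); ring.
Qed.

(** Otherwise the product of the coordinates, which takes the value 1 on the
frames, could not factor through [b]. *)
Lemma tensor_frame_neq0 (b : lb_fiber E x -> lb_fiber F x -> lb_fiber L x) :
  is_tensor_map b -> b (vec FE a x) (vec FF a x) != 0.
Proof.
move=> [_ /(_ C^o) bU]; apply/eqP => b0.
have [h [hE _]] := bU _ (@coord_bilinear 1 C^o 1).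
have := hE (vec FE a x) (vec FF a x); rewrite b0 linear0 !incl_vec// !fcoord_sec//.
by rewrite !mul1r scale1r => /esym/eqP; rewrite oner_eq0.
Qed.

(** A bilinear map [c] factors through this one by sending [vec FL a x] to
[z^-1] times the value of [c] on the frames. *)
Lemma tensor_of_frame (z : C) : z != 0 ->
  is_tensor_map (fun (u : lb_fiber E x) (v : lb_fiber F x) =>
    (z * (fcoord FE a (lb_incl u) * fcoord FF a (lb_incl v))) *: vec FL a x).
Proof.
move=> z0; split=> [|Z c cb]; first exact: coord_bilinear.
pose h (w : lb_fiber L x) : Z := (fcoord FL a (lb_incl w) / z) *:
  c (vec FE a x) (vec FF a x).
have lh : linear h.
  move=> s y y'; rewrite /h fcoordP// scalerA -scalerDl; congr (_ *: _); ring.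
exists (HB.pack_for {linear lb_fiber L x -> Z} h
  (GRing.isLinear.Build C (lb_fiber L x) Z _ h lh)); split=> [u v|h' h'E w] /=.
  rewrite /h fcoordZ// incl_vec// fcoord_sec// mulr1 mulrAC mulfV// mul1r.
  by rewrite -bilinear_frame.
rewrite {1}(vec_fcoord FL w ax) linearZ /=.
have := h'E (vec FE a x) (vec FF a x).
rewrite !incl_vec// !fcoord_sec// !mulr1 linearZ /= /h => <-.
by rewrite scalerA -mulrA mulVf// mulr1.
Qed.

End Line.

(** The products of the frames of [E] and [F] are nonvanishing holomorphic
sections of [L], and [G] acts on them through the product of the two cocycles;
their coordinates in the frames of [L] form the required 0-cochain. *)
Lemma tensor_cohomologous : is_tensor E F L -> cohomologous rho TEF TL.
Proof.
have aE := cm_atlas E; have aF := cm_atlas F; have aL := cm_atlas L.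
move=> [b [bT bh bG]]; apply/cohomologousP => //.
exists (fun a x => fcoord FL a (lb_incl (b x (vec FE a x) (vec FF a x)))).
  apply/cochain0P => a x ax; split; last first.
    apply/eqP => b0; have /eqP := tensor_frame_neq0 ax (bT x).
    by apply; rewrite (vec_fcoord FL (b x _ _) ax) b0 scale0r.
  have hE : holo (X := M) (Y := E) (U a) (fun y => lb_incl (vec FE a y)).
    apply/(regular_onP holP aM aE _ (oc_open a)) => y ay.
    apply: (regular_at_congr holP aM _ (frame_regular_at FE ay)).
    by apply: (near_open (oc_open a) ay) => w aw; rewrite incl_vec.
  have hF : holo (X := M) (Y := F) (U a) (fun y => lb_incl (vec FF a y)).
    apply/(regular_onP holP aM aF _ (oc_open a)) => y ay.
    apply: (regular_at_congr holP aM _ (frame_regular_at FF ay)).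
    by apply: (near_open (oc_open a) ay) => w aw; rewrite incl_vec.
  have hb := (regular_onP holP aM aL _ (oc_open a)).1
    (bh (U a) (vec FE a) (vec FF a) (oc_open a) hE hF) x ax.
  by apply: (regular_at_comp holP aM aL hb); apply: fcoord_regular_at; rewrite proj_incl.
move=> a c g x cx ax.
have vE : lift g (lb_incl (vec FE c x)) = lb_incl (TE a c g x *: vec FE a (rho g x)).
  by rewrite incl_vec// incl_vecZ// (lift_sec FE 1 cx ax) mulr1.
have vF : lift g (lb_incl (vec FF c x)) = lb_incl (TF a c g x *: vec FF a (rho g x)).
  by rewrite incl_vec// incl_vecZ// (lift_sec FF 1 cx ax) mulr1.
have /(congr1 (fcoord FL a)) := bG g x _ _ _ _ vE vF.
have bx : U c (lb_proj (lb_incl (b x (vec FE c x) (vec FF c x)))) by rewrite proj_incl.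
have bgx : U a (rho g (lb_proj (lb_incl (b x (vec FE c x) (vec FF c x))))).
  by rewrite proj_incl.
rewrite (lift_fcoord FL bx bgx) proj_incl => ->.
rewrite (bilinear_frame ax _ _ (bT (rho g x)).1) fcoordZ//.
by rewrite !fcoordZ// !incl_vec// !fcoord_sec// !mulr1 mulrC.
Qed.

(** Over [U a], declare the product of the frames of [E] and [F] to be [mu a]
times the frame of [L]. The cohomology relation for the neutral element of [G]
makes this independent of [a], and for an arbitrary one it makes [G] act
diagonally. *)
Lemma cohomologous_tensor : cohomologous rho TEF TL -> is_tensor E F L.
Proof.
have aE := cm_atlas E; have aF := cm_atlas F; have aL := cm_atlas L.
move=> /(cohomologousP _ TEF0)[mu /cochain0P cmu muE].
have [i iP] := choice (oc_cover U).
pose b x (u : lb_fiber E x) (v : lb_fiber F x) : lb_fiber L x :=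
  (mu (i x) x * (fcoord FE (i x) (lb_incl u) * fcoord FF (i x) (lb_incl v))) *:
    vec FL (i x) x.
(* The formula defining [b] holds for all indices, not only the chosen one. *)
have bE a x (u : lb_fiber E x) (v : lb_fiber F x) : U a x -> lb_incl (b x u v) =
    sec FL a x (mu a x * (fcoord FE a (lb_incl u) * fcoord FF a (lb_incl v))).
  move=> ax; have ax1 : U a (rho 1%g x) by rewrite act1.
  have ux : U (i x) (lb_proj (lb_incl u)) by rewrite proj_incl.
  have ua : U a (rho 1%g (lb_proj (lb_incl u))) by rewrite proj_incl.
  have vx : U (i x) (lb_proj (lb_incl v)) by rewrite proj_incl.
  have va : U a (rho 1%g (lb_proj (lb_incl v))) by rewrite proj_incl.
  have wx : U (i x) (lb_proj (lb_incl (b x u v))) by rewrite proj_incl.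
  have wa : U a (rho 1%g (lb_proj (lb_incl (b x u v)))) by rewrite proj_incl.
  apply: (secE ax); first exact: proj_incl.
  rewrite -[in LHS](lift1 (lb_incl (b x u v))) (lift_fcoord FL wx wa) proj_incl.
  rewrite -[in RHS](lift1 (lb_incl u)) (lift_fcoord FE ux ua) proj_incl.
  rewrite -[in RHS](lift1 (lb_incl v)) (lift_fcoord FF vx va) proj_incl.
  rewrite {1}/b fcoordZ ?iP// incl_vec ?iP// fcoord_sec ?iP// mulr1.
  have := muE a (i x) 1%g x (iP x) ax1; rewrite act1 => H.
  by rewrite mulrA H; ring.
exists b; split.
- move=> x; apply: tensor_of_frame; first exact: iP.
  by case: (cmu (i x) x (iP x)).
- move=> V s t oV hs ht; apply/(regular_onP holP aM aL _ oV) => x Vx.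
  have [a ax] := oc_cover U x.
  have rs := (regular_onP holP aM aE _ oV).1 hs x Vx.
  have rt := (regular_onP holP aM aF _ oV).1 ht x Vx.
  have sx : U a (lb_proj (lb_incl (s x))) by rewrite proj_incl.
  have tx : U a (lb_proj (lb_incl (t x))) by rewrite proj_incl.
  have hc : holC (fun y => mu a y *
      (fcoord FE a (lb_incl (s y)) * fcoord FF a (lb_incl (t y)))) x.
    apply: holC_mul; first by case: (cmu a x ax).
    apply: holC_mul.
      exact: (regular_at_comp holP aM aE rs (fcoord_regular_at FE sx)).
    exact: (regular_at_comp holP aM aF rt (fcoord_regular_at FF tx)).
  apply: (regular_at_congr holP aM _
    (sec_regular_along FL (h := fun y => y) aM ax (regular_at_id _ aM) hc)).
  by apply: (near_open (oc_open a) ax) => y ay; rewrite (bE a).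
- move=> g x u v u' v' uu' vv'.
  have [a ax] := oc_cover U (rho g x).
  have ux : U (i x) (lb_proj (lb_incl u)) by rewrite proj_incl.
  have ua : U a (rho g (lb_proj (lb_incl u))) by rewrite proj_incl.
  have vx : U (i x) (lb_proj (lb_incl v)) by rewrite proj_incl.
  have va : U a (rho g (lb_proj (lb_incl v))) by rewrite proj_incl.
  rewrite (bE a _ u' v' ax) -uu' -vv' (lift_fcoord FE ux ua) (lift_fcoord FF vx va) !proj_incl.
  rewrite (bE (i x) _ u v (iP x)) (lift_sec FL _ (iP x) ax); congr (sec _ _ _ _).
  by rewrite mulrA muE//; ring.
Qed.

End Tensor.

(** * Open images of charts, and a countable base of the complex line *)

Section ChartImage.
Variables (K : numFieldType).

Lemma chart_image_open n (T : topologicalType) (c : chart K n T) (W : set T) :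
  is_chart c -> open W -> open (cfun c @` (cdom c `&` W)).
Proof.
move=> cc oW; rewrite openE => _ [x [cx Wx] <-].
have Wn : \forall y \near x, W y by exact: open_nbhs_nbhs.
apply: filterS (chart_near cc cx Wn) => w [wE cw Ww].
by rewrite -wE; exact: imageP.
Qed.

End ChartImage.

Section SecondCountable.
Variable R : realType.
Local Notation C := (Cfield R).

Definition rat_box (q : (rat * rat) * (rat * rat)) : set C :=
  [set z | (ratr q.1.1 < complex.Re z < ratr q.1.2) /\
           (ratr q.2.1 < complex.Im z < ratr q.2.2)].

Lemma rat_box_open q : open (rat_box q).
Proof.
have [cRe cIm] := ReIm_continuous R.
have oI (a b : R) : open [set x : R | a < x < b].
  have -> : [set x : R | a < x < b] = [set` `]a, b[].
    by apply/seteqP; split=> x /=; rewrite in_itv.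
  exact: interval_open.
apply: openI.
  apply: (@open_comp _ _ (fun z : C => complex.Re z)
    [set x | ratr q.1.1 < x < ratr q.1.2]) => [z _|]; [exact: cRe|exact: oI].
apply: (@open_comp _ _ (fun z : C => complex.Im z)
  [set x | ratr q.2.1 < x < ratr q.2.2]) => [z _|]; [exact: cIm|exact: oI].
Qed.

Lemma nbhs_rat (x : R) (P : set R) : nbhs x P ->
  exists q : rat * rat, (ratr q.1 < x < ratr q.2) /\
    (forall y, ratr q.1 < y < ratr q.2 -> P y).
Proof.
move=> /nbhs_ballP[e /= e0 xP].
have [a] := rat_in_itvoo (x := x - e) (y := x) (ltac:(lra)).
have [b] := rat_in_itvoo (x := x) (y := x + e) (ltac:(lra)).
rewrite !in_itv /= => /andP[xb be] /andP[ea ax].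
exists (a, b); split=> [|y /= /andP[ay yb]]; first by rewrite /= ax.
apply: xP; rewrite /ball /= ltr_norml; lra.
Qed.

(** Continuity of the bijection from R^2 to the complex line turns neighbourhoods
into neighbourhoods of the pair of real and imaginary parts. *)
Lemma nbhs_rat_box (z : C) (A : set C) : nbhs z A ->
  exists q, rat_box q z /\ rat_box q `<=` A.
Proof.
move=> zA.
have cz : {for (complex.Re z, complex.Im z),
    continuous (fun p : R * R => (p.1 +i* p.2 : C))}.
  by apply: complex_pair_continuous; [exact: cvg_fst|exact: cvg_snd].
have /= : nbhs ((complex.Re z +i* complex.Im z) : C) A by case: z zA {cz}.
move=> /cz[[P Q] /= [zP zQ] PQA].
have [p [pz pP]] := nbhs_rat zP; have [q [qz qQ]] := nbhs_rat zQ.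
exists (p, q); split=> // w [pw qw].
have := PQA (complex.Re w, complex.Im w) (conj (pP _ pw) (qQ _ qw)).
by case: w {pw qw}.
Qed.

End SecondCountable.

(** * The total space glued from a cocycle *)

(** The set underlying the total space: [(x, z)] stands for [z] times the frame of
index [base_index x]. As this index does not vary continuously with [x], the
topology is not that of the product. *)
Definition total_space (R : realType) (k : lie_kind) (m n : nat) (G : lieGroup R k m)
  (M : complexManifold R n) (rho : action G M) (N : cocycle rho) : Type :=
  (M * Cfield R)%type.

Section TotalSpace.
Variables (R : realType) (k : lie_kind) (m n : nat).
Variables (G : lieGroup R k m) (M : complexManifold R n) (rho : action G M).
Local Notation C := (Cfield R).
Local Notation C1 := (line_charted (Cfield R)).
Local Notation MC := (prod_charted M C1).
Local Notation hol := (@holomorphic_on R).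
Local Notation rk := (@lie_reg R k).

Let holP := holomorphic_is_regularity R.
Let rkP := lie_reg_is_regularity R k.
Let aM : is_atlas hol M := cm_atlas M.
Let aC1 : is_atlas hol C1 := line_is_atlas holP.
Let aMC : is_atlas hol MC := prod_is_atlas holP aM aC1.

Variable N : cocycle rho.
Local Notation U := (coc_cover N).
Local Notation L := (@coc_fun _ _ _ _ G M rho N).
Let cL : is_cocycle rho L := coc_cocycle N.

Definition base_index (x : M) : oc_index U := sval (cid (oc_cover U x)).

Lemma base_indexP x : U (base_index x) x.
Proof. exact: proj2_sig (cid (oc_cover U x)). Qed.

Local Notation i0 := base_index.

Local Notation T := (total_space N).
HB.instance Definition _ := Choice.copy T (M * C)%type.

Definition total_coord (a : oc_index U) (e : T) : M * C :=
  (e.1, L a (i0 e.1) 1%g e.1 * e.2).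
Definition total_sec (a : oc_index U) (p : M * C) : T :=
  (p.1, L (i0 p.1) a 1%g p.1 * p.2).
Local Notation tcrd := total_coord.
Local Notation tsec := total_sec.

(** The finest topology for which all [total_sec a] are continuous over
[U a]. *)
Definition total_open (W : set T) : Prop :=
  forall a, open [set p : M * C | U a p.1 /\ W (tsec a p)].

Let totalT : total_open setT.
Proof.
move=> a; have -> : [set p : M * C | U a p.1 /\ [set: T] (tsec a p)] = U a `*` setT.
  by apply/seteqP; split=> p [].
by apply: openX; [exact: oc_open|exact: openT].
Qed.

Let totalI : setI_closed total_open.
Proof.
move=> V W oV oW a; have -> : [set p : M * C | U a p.1 /\ (V `&` W) (tsec a p)] =
    [set p : M * C | U a p.1 /\ V (tsec a p)] `&` [set p : M * C | U a p.1 /\ W (tsec a p)].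
  by apply/seteqP; split=> [p [? []]|p [[? ?] [? ?]]].
exact: openI.
Qed.

Let total_bigU (I : Type) (f : I -> set T) :
  (forall i, total_open (f i)) -> total_open (\bigcup_i f i).
Proof.
move=> of_ a; have -> : [set p : M * C | U a p.1 /\ (\bigcup_i f i) (tsec a p)] =
    \bigcup_i [set p : M * C | U a p.1 /\ f i (tsec a p)].
  apply/seteqP; split=> [p [ap [i _ ip]]|p [i _ [ap ip]]]; first by exists i.
  by split=> //; exists i.
by apply: bigcup_open => i _; exact: of_.
Qed.

HB.instance Definition _ := isOpenTopological.Build T totalT totalI total_bigU.

Lemma total_openE (W : set T) : open W <-> total_open W.
Proof. by []. Qed.

Lemma tcrd_tsec a b p : U a p.1 -> U b p.1 -> tcrd b (tsec a p) = (p.1, L b a 1%g p.1 * p.2).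
Proof.
move=> ap bp; rewrite /tcrd /tsec /= mulrA -(transM cL)//; exact: base_indexP.
Qed.

Lemma tcrd_tsecK a p : U a p.1 -> tcrd a (tsec a p) = p.
Proof. by move=> ap; rewrite tcrd_tsec// (trans1 cL)// mul1r -surjective_pairing. Qed.

Lemma tsec_tcrdK a e : U a e.1 -> tsec a (tcrd a e) = e.
Proof.
move=> ae; rewrite /tcrd /tsec /= mulrA -(transM cL)//; try exact: base_indexP.
by rewrite (trans1 cL) ?mul1r -?surjective_pairing//; exact: base_indexP.
Qed.

Lemma change_regular_at a b p : U a p.1 -> U b p.1 ->
  regular_at (X := MC) (Y := MC) hol (fun q => (q.1, L b a 1%g q.1 * q.2)) p.
Proof.
move=> ap bp; have r1 := regular_at_fst (Y := C1) holP aM p.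
apply: (regular_at_pair holP r1).
have r2 : regular_at (X := MC) (Y := C1) hol (fun q => L b a 1%g q.1) p.
  exact: (regular_at_comp holP aMC aM r1 (trans_holC cL bp ap)).
exact: (regular_at_comp holP aMC (prod_is_atlas holP aC1 aC1)
  (regular_at_pair holP r2 (regular_at_snd (X := M) holP aC1 p)) (regular_at_mul _)).
Qed.

Lemma near_fst (V : set M) (p : M * C) : open V -> V p.1 -> \forall q \near p, V q.1.
Proof.
by move=> oV Vp; apply: (near_open (openX oV (@openT C)) (conj Vp Logic.I)) => q [].
Qed.

Let near_UI a b (p : M * C) : U a p.1 -> U b p.1 ->
  \forall q \near p, U a q.1 /\ U b q.1.
Proof.
by move=> ap bp; apply: (@near_fst (U a `&` U b)) => //; apply: openI; exact: oc_open.
Qed.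

Lemma tsec_continuous a p : U a p.1 -> {for p, continuous (tsec a)}.
Proof.
move=> ap A; rewrite nbhsE => -[W [oW Wp] WA].
have Wn : \forall q \near p, U a q.1 /\ W (tsec a q).
  by apply: open_nbhs_nbhs; split=> //; exact: (total_openE W).1 oW a.
by apply: filterS Wn => q [_ /WA].
Qed.

Lemma total_preim_open V : open V -> open [set e : T | V e.1].
Proof.
move=> oV; apply/total_openE => a.
have -> : [set p : M * C | U a p.1 /\ [set e : T | V e.1] (tsec a p)] =
    (U a `&` V) `*` setT.
  by apply/seteqP; split=> [p [? ?]|p [[? ?] _]].
by apply: openX; [apply: openI => //; exact: oc_open|exact: openT].
Qed.

Lemma tcrd_continuous a e : U a e.1 -> {for e, continuous (tcrd a)}.
Proof.
move=> ae A; rewrite nbhsE => -[W [oW We] WA].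
suff oV : open [set e : T | U a e.1 /\ W (tcrd a e)].
  have Ve : [set e : T | U a e.1 /\ W (tcrd a e)] e by split.
  by apply: filterS (open_nbhs_nbhs (conj oV Ve)) => q [_ /WA].
apply/total_openE => b; rewrite openE => p [bp [ap Wp]].
move: Wp; rewrite /= in ap *; rewrite tcrd_tsec// => Wp.
have Wn : \forall q \near p, W (q.1, L a b 1%g q.1 * q.2).
  by apply: (change_regular_at bp ap).1; exact: open_nbhs_nbhs.
have an := near_UI ap bp.
near=> q; have [aq bq] : U a q.1 /\ U b q.1 by near: q.
split=> //; split=> //; rewrite tcrd_tsec//; near: q; exact: Wn.
Unshelve. all: by end_near. Qed.

Definition line_chart : chart C 1 C :=
  Chart setT (fun z : C => const_mx z) (fun w : 'rV[C]_1 => w 0 0).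
Local Notation pchart c := (prod_chart c line_chart).

Definition total_chart a (c : chart C n M) : chart C (n + 1) T :=
  let d := pchart c in
  @Chart C (n + 1) T [set e : T | U a e.1 /\ cdom c e.1]
    (cfun d \o tcrd a) (tsec a \o cinv d).

Definition total_charted : charted C (n + 1) :=
  Charted [set total_chart a c | a in setT & c in atlas M].

Let pchartP c : atlas M c -> atlas MC (pchart c).
Proof. by move=> Ac; exists c => //; eexists; first reflexivity. Qed.

Lemma total_is_chart a c : atlas M c -> is_chart (total_chart a c).
Proof.
move=> Ac; have pP := atlas_chart aMC (pchartP Ac).
have imE : cfun (total_chart a c) @` cdom (total_chart a c) =
    cfun (pchart c) @` (cdom (pchart c) `&` (U a `*` setT)).
  apply/seteqP; split=> [_ [e [ae ce] <-]|_ [p [[cp _] [ap _]] <-]].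
    by exists (tcrd a e); [split; split|].
  by exists (tsec a p); [|exact: (congr1 (cfun (pchart c)) (tcrd_tsecK ap))].
have [op ip pK pc pi] := pP; have [oc _ _ _ _] := atlas_chart aM Ac.
split.
- by apply: (total_preim_open (V := U a `&` cdom c)); apply: openI => //; exact: oc_open.
- rewrite imE; apply: chart_image_open => //.
  by apply: openX; [exact: oc_open|exact: openT].
- move=> e [ae ce]; rewrite [LHS]/= -[RHS](tsec_tcrdK ae); congr (tsec a _).
  exact: (pK (tcrd a e)).
- move=> e [ae ce]; apply: continuous_comp; first exact: tcrd_continuous.
  exact: pc.
- rewrite imE => _ [p [cp [ap _]] <-]; apply: continuous_comp; first exact/pi/imageP.
  by rewrite pK//; exact: tsec_continuous.
Qed.

Lemma total_is_atlas : is_atlas hol total_charted.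
Proof.
split.
- by move=> _ [a _ [c Ac <-]]; exact: total_is_chart.
- move=> e; have [c Ac ce] := atlas_cover aM e.1.
  exists (total_chart (i0 e.1) c); last by split=> //; exact: base_indexP.
  by exists (i0 e.1) => //; exists c.
- move=> _ _ e [a _ [c Ac <-]] [b _ [d Ad <-]] [ae ce] [be de].
  have := (change_regular_at (p := tcrd a e) ae be).2 _ _ (pchartP Ac) (pchartP Ad)
    (conj ce Logic.I) (conj de Logic.I).
  apply: (reg_at_congr holP).
  have abn := near_UI (p := tcrd a e) ae be.
  have := chart_near (atlas_chart aMC (pchartP Ac)) (x := tcrd a e) (conj ce Logic.I) abn.
  apply: filterS => w [_ _ [aw bw]].
  exact: (congr1 (cfun (pchart d)) (esym (tcrd_tsec aw bw))).
Qed.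

Let aT := total_is_atlas.

Lemma total_chart_at e : exists2 c, atlas M c & cdom c e.1 /\
  forall a, U a e.1 -> atlas total_charted (total_chart a c) /\ cdom (total_chart a c) e.
Proof.
have [c Ac ce] := atlas_cover aM e.1; exists c => //; split=> // a ae; split=> //.
by exists a => //; exists c.
Qed.

Let chart_id a c p : atlas M c -> cdom c p.1 -> U a p.1 ->
  reg_at hol (cfun (pchart c) \o (fun q => tcrd a (tsec a q)) \o cinv (pchart c))
    (cfun (pchart c) p).
Proof.
move=> Ac cp ap; have an := near_fst (oc_open a) ap.
have pn := chart_near (atlas_chart aMC (pchartP Ac)) (x := p) (conj cp Logic.I) an.
apply: (reg_at_congr holP) (reg_total_at _ (reg_id holP _)).
apply: filterS pn => w [wE _ aw].
by rewrite -[LHS]wE; exact: (congr1 (cfun (pchart c)) (esym (tcrd_tsecK aw))).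
Qed.

Lemma tcrd_regular_at a e : U a e.1 ->
  regular_at (X := total_charted) (Y := MC) hol (tcrd a) e.
Proof.
move=> ae; have [c Ac [ce /(_ a ae)[At ct]]] := total_chart_at e.
apply: (regular_at_chart holP aT aMC (f := tcrd a) (x := e) At
  (pchartP Ac) ct (conj ce Logic.I)).
  exact: tcrd_continuous.
exact: (chart_id (p := tcrd a e) Ac ce ae).
Qed.

Lemma tsec_regular_at a p : U a p.1 ->
  regular_at (X := MC) (Y := total_charted) hol (tsec a) p.
Proof.
move=> ap; have [c Ac [cp /(_ a ap)[At ct]]] := total_chart_at (tsec a p).
apply: (regular_at_chart holP aMC aT (f := tsec a) (x := p) (pchartP Ac)
  At (conj cp Logic.I) ct).
  exact: tsec_continuous.
exact: (chart_id (p := p) Ac cp ap).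
Qed.

End TotalSpace.

(** * The equivariant bundle of a cocycle *)

Section CocycleBundle.
Variables (R : realType) (k : lie_kind) (m n : nat).
Variables (G : lieGroup R k m) (M : complexManifold R n) (rho : action G M).
Local Notation C := (Cfield R).
Local Notation C1 := (line_charted (Cfield R)).
Local Notation MC := (prod_charted M C1).
Local Notation hol := (@holomorphic_on R).
Local Notation rk := (@lie_reg R k).
Local Notation GX X := (prod_charted (lg_charted G) (underlying k X)).

Let holP := holomorphic_is_regularity R.
Let rkP := lie_reg_is_regularity R k.
Let aM : is_atlas hol M := cm_atlas M.
Let aC1 : is_atlas hol C1 := line_is_atlas holP.
Let aMC : is_atlas hol MC := prod_is_atlas holP aM aC1.
Let aG : is_atlas rk (lg_charted G) := manifold_atlas rkP (lg_manifold G).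

Variable N : cocycle rho.
Local Notation U := (coc_cover N).
Local Notation L := (@coc_fun _ _ _ _ G M rho N).
Local Notation T := (total_space N).
Local Notation TT := (total_charted N).
Local Notation i0 := (base_index N).
Local Notation tcrd := (@total_coord _ _ _ _ G M rho N).
Local Notation tsec := (@total_sec _ _ _ _ G M rho N).
Let cL : is_cocycle rho L := coc_cocycle N.
Let aT : is_atlas hol TT := total_is_atlas N.

Definition total_proj (e : T) : M := e.1.

Lemma total_proj_regular_at e : regular_at (X := TT) (Y := M) hol total_proj e.
Proof.
have e1 : U (i0 e.1) e.1 := base_indexP N e.1.
exact: (regular_at_comp holP aT aMC (tcrd_regular_at e1)
  (regular_at_fst (Y := C1) holP aM _)).
Qed.

(** Two points that cannot be separated have the same projection, by separation
in [M], and then the same coordinate in a trivialisation around it. *)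
Lemma total_hausdorff : hausdorff_space T.
Proof.
have cluster_comp (S : topologicalType) (f : T -> S) (e e' : T) :
    hausdorff_space S -> {for e, continuous f} -> {for e', continuous f} ->
    cluster (nbhs e) e' -> f e = f e'.
  move=> hS fe fe' cl; apply: hS => A B Ae Be'.
  by have [y [Ay By]] := cl _ _ (fe _ Ae) (fe' _ Be'); exists (f y).
have hM : hausdorff_space M by case: (cm_manifold M).
have hC : hausdorff_space C := @norm_hausdorff C C^o.
move=> e e' cl.
have ee1 : e.1 = e'.1.
  apply: (cluster_comp M total_proj) => //; exact: (total_proj_regular_at _).1.
have ae := base_indexP N e.1; have ae' : U (i0 e.1) e'.1 by rewrite -ee1.
have ee2 : (tcrd (i0 e.1) e).2 = (tcrd (i0 e.1) e').2.
  apply: (cluster_comp C (fun y => (tcrd (i0 e.1) y).2) _ _ hC _ _ cl).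
  - by apply: continuous_comp (tcrd_continuous ae) _; exact: cvg_snd.
  - by apply: continuous_comp (tcrd_continuous ae') _; exact: cvg_snd.
rewrite -(tsec_tcrdK ae) -(tsec_tcrdK ae'); congr (tsec _ _).
by rewrite [LHS]surjective_pairing [RHS]surjective_pairing ee2 /= ee1.
Qed.

(** The base consists of products of basic open sets [V'] of [M] with rational
boxes. Such a product is only meaningful in a trivialisation; as there may be
uncountably many of them, the trivialisation is attached to a second basic open
set [V], contained in a member of the cover, so that [V'] can be shrunk without
changing the trivialisation. *)
Lemma total_second_countable : @second_countable T.
Proof.
have [_ [B cB [oB Bx]] _ _ _] := cm_manifold M.
(* [al V] selects a member of the cover that contains [V], if there is one. *)
have [al alP] : {al : set M -> option (oc_index U) |
    forall V, if al V is Some a then V `<=` U a else ~ exists a, V `<=` U a}.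
  exists (fun V => if pselect (exists a, V `<=` U a) is left H then Some (sval (cid H))
                   else None) => V.
  by case: pselect => // H; exact: proj2_sig (cid H).
have cq : countable [set: (rat * rat) * (rat * rat)] by [].
pose W (p : (set M * set M) * ((rat * rat) * (rat * rat))) : set T :=
  if al p.1.1 is Some a then
    [set e : T | [/\ p.1.1 e.1, p.1.2 e.1 & rat_box p.2 (tcrd a e).2]]
  else set0.
exists (W @` ((B `*` B) `*` setT)).
  apply: sub_countable (card_image_le _ _) _.
  by apply: countableX => //; exact: countableX.
split=> [_ [[[V V'] q] [[/= BV BV'] _] <-]|e A eA].
  rewrite /W /=; have := alP V; case: (al V) => [a Va|_]; last exact: open0.
  have oVV : open (V `&` V') by apply: openI; exact: oB.
  have -> : [set e : T | [/\ V e.1, V' e.1 & rat_box q (tcrd a e).2]] =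
      [set e : T | [/\ (V `&` V') e.1 & rat_box q (tcrd a e).2]].
    by apply/seteqP; split=> [f [? ? ?]|f [[? ?] ?]].
  rewrite openE => f [[Vf Vf'] qf].
  have H1 : \forall f' \near f, (V `&` V') f'.1.
    by apply: (total_proj_regular_at f).1; exact: open_nbhs_nbhs.
  have H2 : \forall f' \near f, rat_box q (tcrd a f').2.
    have c2 : {for f, continuous (fun f' => (tcrd a f').2)}.
      by apply: continuous_comp (tcrd_continuous (Va _ Vf)) _; exact: cvg_snd.
    by apply: c2; apply: open_nbhs_nbhs; split=> //; exact: rat_box_open.
  by apply: filterS (filterI H1 H2) => f' [].
have nB (V : set M) x : open V -> V x -> exists2 V', B V' & V' x /\ V' `<=` V.
  move=> oV Vx; have [V' [BV' V'x] V'V] := Bx x V (open_nbhs_nbhs (conj oV Vx)).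
  by exists V'.
have [V BV [Ve VU]] := nB _ _ (oc_open (i0 e.1)) (base_indexP N e.1).
have : if al V is Some a then V `<=` U a else ~ exists a, V `<=` U a := alP V.
case aV : (al V) => [a|]; last by case; exists (i0 e.1).
move=> Va; have ae := Va _ Ve.
have : nbhs (tcrd a e) (tsec a @^-1` A).
  by apply: (tsec_continuous (p := tcrd a e) ae); rewrite tsec_tcrdK.
move=> [[P Q] /= [eP eQ] PQA].
have [q [qe qQ]] := nbhs_rat_box eQ.
move: eP; rewrite nbhsE => -[P' [oP' P'e] P'P].
have [V' BV' [V'e V'P]] := nB _ _ oP' P'e.
exists (W ((V, V'), q)); first by split; [exists ((V, V'), q)|rewrite /W /= aV].
rewrite /W /= aV => f [Vf V'f qf].
rewrite -(tsec_tcrdK (Va _ Vf)); apply: (PQA (tcrd a f)); split.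
  exact/P'P/V'P.
exact: qQ.
Qed.

Lemma total_is_manifold : is_manifold hol TT.
Proof.
split.
- exact: total_hausdorff.
- exact: total_second_countable.
- exact: (atlas_chart aT).
- exact: (atlas_cover aT).
- move=> c d Ac Ad; apply: (reg_at_on holP) => _ [e [ce de] <-].
  exact: (atlas_transition aT).
Qed.

Definition total_manifold : complexManifold R (n + 1) :=
  ComplexManifold total_is_manifold.

Definition total_incl (x : M) (u : C^o) : total_manifold := (x, u) : T.

Lemma total_trivialization a :
  [/\ holo (X := total_manifold) (Y := MC) (total_proj @^-1` U a) (tcrd a) /\
        holo (X := MC) (Y := total_manifold) (U a `*` setT) (tsec a),
      forall e, U a (total_proj e) ->
        (tcrd a e).1 = total_proj e /\ tsec a (tcrd a e) = e,
      forall p, U a p.1 -> total_proj (tsec a p) = p.1 /\ tcrd a (tsec a p) = p &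
      forall y, U a y -> linear (fun u : C^o => (tcrd a (total_incl y u)).2 : C^o)].
Proof.
split.
- split.
    have oU : open (total_proj @^-1` U a).
      by apply: open_comp (oc_open _) => e _; exact: (total_proj_regular_at e).1.
    by apply/(regular_onP holP aT aMC _ oU) => e; exact: tcrd_regular_at.
  have oU : open (U a `*` [set: C]) by apply: openX; [exact: oc_open|exact: openT].
  by apply/(regular_onP holP aMC aT _ oU) => p [ap _]; exact: tsec_regular_at.
- by move=> e ae; split=> //; exact: tsec_tcrdK.
- by move=> p ap; split=> //; exact: tcrd_tsecK.
- by move=> y _ z u v; rewrite /= mulrDr; congr (_ + _); exact: mulrCA.
Qed.

Lemma total_trivial (x : M) : exists (V : set M) (t : total_manifold -> M * C)
    (s : M * C -> total_manifold),
  [/\ open V /\ V x,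
      holo (Y := MC) ((total_proj : total_manifold -> M) @^-1` V) t /\
        holo (X := MC) (V `*` setT) s,
      forall e, V (total_proj e) -> (t e).1 = total_proj e /\ s (t e) = e,
      forall p, V p.1 -> total_proj (s p) = p.1 /\ t (s p) = p &
      forall y, V y -> linear (fun u : C^o => (t (total_incl y u)).2 : C^o)].
Proof.
exists (U (i0 x)), (tcrd (i0 x)), (tsec (i0 x)).
have [? ? ? ?] := total_trivialization (i0 x); split=> //.
by split; [exact: oc_open|exact: base_indexP].
Qed.

Lemma total_incl_inj x : injective (@total_incl x).
Proof. by move=> u v []. Qed.

Lemma total_incl_range x :
  range (@total_incl x) = (total_proj : total_manifold -> M) @^-1` [set x].
Proof. by apply/seteqP; split=> [_ [u _ <-]//|[y z] /= <-]; exists z. Qed.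

Lemma total_proj_holo : holo (X := total_manifold) (Y := M) setT total_proj.
Proof.
by apply/(regular_onP holP aT aM _ openT) => e _; exact: total_proj_regular_at.
Qed.

Lemma total_rank (x : M) : \dim {: (C^o : vectType C)} = 1%N.
Proof. by rewrite dimvf. Qed.

Definition total_bundle : lineBundle M :=
  @LineBundle R n M total_manifold total_proj total_proj_holo
    (fun _ => C^o : vectType C) total_rank total_incl total_incl_inj total_incl_range
    total_trivial.

Definition total_lift (g : G) (e : total_bundle) : total_bundle :=
  (rho g (e : T).1, L (i0 (rho g (e : T).1)) (i0 (e : T).1) g (e : T).1 * (e : T).2) : T.

Lemma total_lift1 e : total_lift 1%g e = e.
Proof.
case: e => x z; rewrite /total_lift /= act1 (trans1 cL) ?mul1r//.
exact: base_indexP.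
Qed.

Lemma total_liftM g h e : total_lift (g * h)%g e = total_lift g (total_lift h e).
Proof.
case: e => x z; rewrite /total_lift /= actM; congr (_, _).
rewrite mulrA; congr (_ * _); apply: (cocycleM cL); exact: base_indexP.
Qed.

(** In [total_lift] the indices depend on the points; any fixed indices give the
same map near given points, which is what regularity requires. *)
Lemma total_liftE a b g (e : T) : U b e.1 -> U a (rho g e.1) ->
  total_lift g e = tsec a (rho g e.1, L a b g e.1 * (tcrd b e).2).
Proof.
move=> be ae; rewrite /total_lift; congr (_, _).
rewrite /= !mulrA; congr (_ * _).
exact: (cocycle_change cL ae (base_indexP _ _) be (base_indexP _ _)).
Qed.

Lemma total_lift_holo g : holo (X := total_bundle) (Y := total_bundle) setT (total_lift g).
Proof.
apply/(regular_onP holP aT aT _ openT) => e _.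
have [b be] := oc_cover U (e : T).1; have [a ae] := oc_cover U (rho g (e : T).1).
have r0 := regular_at_comp holP aT aM (total_proj_regular_at e) (act_holo_at rho g _).
have r1 : regular_at (X := TT) (Y := C1) hol (fun f => L a b g (total_proj f)) e.
  exact: (regular_at_comp holP aT aM (total_proj_regular_at e) (cocycle_holC cL be ae)).
have r2 := regular_at_comp holP aT aMC (tcrd_regular_at be)
  (regular_at_snd (X := M) holP aC1 _).
have r3 := regular_at_comp holP aT (prod_is_atlas holP aC1 aC1)
  (regular_at_pair holP r1 r2) (regular_at_mul _).
have r4 := regular_at_comp holP aT aMC (regular_at_pair holP r0 r3)
  (tsec_regular_at (p := (rho g (e : T).1, L a b g (e : T).1 * (tcrd b e).2)) ae).
apply: (regular_at_congr holP aT _ r4).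
have n1 : \forall f \near (e : T), U b f.1.
  by apply: (total_proj_regular_at e).1; apply: open_nbhs_nbhs; split=> //; exact: oc_open.
have n2 : \forall f \near (e : T), U a (rho g f.1).
  by apply: (r0.1 (U a)); apply: open_nbhs_nbhs; split=> //; exact: oc_open.
by apply: filterS (filterI n1 n2) => f [bf af]; rewrite (total_liftE bf af).
Qed.

Lemma total_lift_regular :
  jointly_regular (X := total_bundle) (Y := total_bundle) setT
    (fun p : G * total_bundle => total_lift p.1 p.2 : total_bundle).
Proof.
have aUT := underlying_is_atlas k aT; have aUM := underlying_is_atlas k aM.
have aGT : is_atlas rk (GX TT) := prod_is_atlas rkP aG aUT.
have aGM : is_atlas rk (GX M) := prod_is_atlas rkP aG aUM.
apply/(regular_onP rkP aGT aUT _ openT) => -[g e] _.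
have [b be] := oc_cover U (e : T).1; have [a ae] := oc_cover U (rho g (e : T).1).
have rg : regular_at (X := GX TT) (Y := lg_charted G) rk fst (g, e) :=
  regular_at_fst (Y := underlying k TT) rkP aG (g, e).
have re : regular_at (X := GX TT) (Y := underlying k TT) rk snd (g, e) :=
  regular_at_snd (X := lg_charted G) rkP aUT (g, e).
have rp : regular_at (X := GX TT) (Y := underlying k M) rk
    (fun p : G * T => total_proj p.2) (g, e) :=
  regular_at_comp rkP aGT aUT re
    (underlying_regular_at k (total_proj_regular_at e)).
have rgp := regular_at_pair rkP rg rp.
have r0 : regular_at (X := GX TT) (Y := underlying k M) rk
    (fun p : G * T => rho p.1 (total_proj p.2)) (g, e) :=
  regular_at_comp rkP aGT aGM rgp (act_regular_at rho _).
have r1 : regular_at (X := GX TT) (Y := underlying k C1) rk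
    (fun p : G * T => L a b p.1 (total_proj p.2)) (g, e) :=
  regular_at_comp rkP aGT aGM rgp (cocycle_regC cL be ae).
have r2 : regular_at (X := GX TT) (Y := underlying k C1) rk
    (fun p : G * T => (tcrd b p.2).2) (g, e) :=
  regular_at_comp rkP aGT aUT re (underlying_regular_at k
    (regular_at_comp holP aT aMC (tcrd_regular_at be)
      (regular_at_snd (X := M) holP aC1 _))).
have r3 : regular_at (X := GX TT) (Y := underlying k C1) rk
    (fun p : G * T => L a b p.1 (total_proj p.2) * (tcrd b p.2).2) (g, e) :=
  regular_at_comp rkP aGT (underlying_is_atlas k (prod_is_atlas holP aC1 aC1))
    (regular_at_underlying_pair r1 r2) (underlying_regular_at k (regular_at_mul _)).
have r4 := regular_at_comp rkP aGT (underlying_is_atlas k aMC)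
  (regular_at_underlying_pair r0 r3) (underlying_regular_at k
  (tsec_regular_at (p := (rho g (e : T).1, L a b g (e : T).1 * (tcrd b e).2)) ae)).
apply: (regular_at_congr rkP aGT _ r4).
have n1 : \forall p \near ((g, e) : G * T), U b p.2.1.
  by apply: (rp.1 (U b)); apply: open_nbhs_nbhs; split=> //; exact: oc_open.
have n2 : \forall p \near ((g, e) : G * T), U a (rho p.1 p.2.1).
  by apply: (r0.1 (U a)); apply: open_nbhs_nbhs; split=> //; exact: oc_open.
by apply: filterS (filterI n1 n2) => -[h f] [bf af]; rewrite /= (total_liftE bf af).
Qed.

Lemma total_lift_proj g (e : total_bundle) :
  lb_proj (total_lift g e) = rho g (lb_proj e).
Proof. by []. Qed.

Lemma total_lift_linear g :
  fiberwise_linear (E := total_bundle) (F := total_bundle) (rho g) (total_lift g).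
Proof.
move=> x; pose A (u : C^o) : C^o := L (i0 (rho g x)) (i0 x) g x * u.
have lA : linear A by move=> z u v; rewrite /A mulrDr; congr (_ + _); exact: mulrCA.
by exists (HB.pack_for {linear C^o -> C^o} A (GRing.isLinear.Build C C^o C^o _ A lA)).
Qed.

Definition cocycle_bundle : equivariantLineBundle rho :=
  EquivariantLineBundle total_lift1 total_liftM total_lift_regular total_lift_holo
    total_lift_proj total_lift_linear.

Lemma cocycle_bundle_framing : exists F : framing cocycle_bundle U,
  forall a b g x, U b x -> U a (rho g x) -> lift_cocycle F a b g x = L a b g x.
Proof.
have triv a : is_trivialization (E := total_bundle) (U a) (tcrd a) (tsec a).
  exact: total_trivialization.
exists (Framing triv) => a b g x bx ax.
change ((tcrd a (total_lift g (tsec b (x, 1)))).2 = L a b g x).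
rewrite (total_liftE (e := tsec b (x, 1)) bx ax) tcrd_tsecK//.
by rewrite (tcrd_tsecK (p := (x, 1)) bx) [LHS]mulr1.
Qed.

End CocycleBundle.

(** * Bundles classified by cocycles *)

Section Classification.
Variables (R : realType) (k : lie_kind) (m n : nat).
Variables (G : lieGroup R k m) (M : complexManifold R n) (rho : action G M).
Local Notation bundle := (equivariantLineBundle rho).
Local Notation cofun L := (@coc_fun _ _ _ _ G M rho L).

(** A bundle has many cocycles, one for each framing. *)
Definition has_cocycle (E : bundle) (L : cocycle rho) : Prop :=
  exists F : framing E (coc_cover L), forall a b g x,
    coc_cover L b x -> coc_cover L a (rho g x) -> lift_cocycle F a b g x = cofun L a b g x.

Lemma has_cocycle_exists (E : bundle) : exists L, has_cocycle E L.
Proof.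
have [U [F]] := framing_exists E.
by exists (Cocycle (lift_cocycle_is_cocycle F)), F.
Qed.

Lemma has_cocycle_surj (L : cocycle rho) : exists E, has_cocycle E L.
Proof. by exists (cocycle_bundle L); exact: cocycle_bundle_framing. Qed.

Lemma cohomologous_eq (U : openCover M) (L1 L2 L1' L2' : cochain1 G U) :
  (forall a b g x, U b x -> U a (rho g x) -> L1 a b g x = L2 a b g x) ->
  (forall a b g x, U b x -> U a (rho g x) -> L1' a b g x = L2' a b g x) ->
  cohomologous rho L1 L1' -> cohomologous rho L2 L2'.
Proof.
move=> E E' [mu cmu muE]; exists mu => // a b g x bx ax.
by rewrite -E// -E'//; exact: muE.
Qed.

(** Framings restrict to refinements, so that both bundles can be framed over a
common cover. *)
Lemma has_cocycle_equiv (E F : bundle) L N :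
  has_cocycle E L -> has_cocycle F N -> elb_equiv E F <-> coc_equiv L N.
Proof.
move=> [FE EL] [FF FN]; split=> [EF|[V [r [r' [rP rP' LN]]]]].
  have fP := @refines_fst _ _ M (coc_cover L) (coc_cover N).
  have gP := @refines_snd _ _ M (coc_cover L) (coc_cover N).
  exists (capCover (coc_cover L) (coc_cover N)), fst, snd; split=> //.
  move/(equiv_cohomologous (framing_pullback fP FE) (framing_pullback gP FF)): EF.
  apply: cohomologous_eq => a b g x [bx bx'] [ax ax']; first exact: EL.
  exact: FN.
apply/(equiv_cohomologous (framing_pullback rP FE) (framing_pullback rP' FF)).
apply: cohomologous_eq LN => a b g x bx ax.
  by apply/esym/EL; exact: rP.
by apply/esym/FN; exact: rP'.
Qed.

Lemma has_cocycle_tensor (E F Z : bundle) L N P :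
  has_cocycle E L -> has_cocycle F N -> has_cocycle Z P ->
  is_tensor E F Z <-> is_coc_product L N P.
Proof.
move=> [FE EL] [FF FN] [FZ ZP]; split=> [EF|[V [r [s [t [rP sP tP LN]]]]]].
  pose W := capCover (capCover (coc_cover L) (coc_cover N)) (coc_cover P).
  have rP : @refines _ _ M W (coc_cover L) (fun i => i.1.1) by move=> i x [[]].
  have sP : @refines _ _ M W (coc_cover N) (fun i => i.1.2) by move=> i x [[]].
  have tP : @refines _ _ M W (coc_cover P) (fun i => i.2) by move=> i x [].
  exists W, (fun i => i.1.1), (fun i => i.1.2), (fun i => i.2); split=> //.
  move/(tensor_cohomologous (framing_pullback rP FE) (framing_pullback sP FF)
    (framing_pullback tP FZ)): EF.
  apply: cohomologous_eq => a b g x [[bL bN] bP] [[aL aN] aP]; last exact: ZP.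
  by congr (_ * _); [exact: EL|exact: FN].
apply: (cohomologous_tensor (FE := framing_pullback rP FE)
  (FF := framing_pullback sP FF) (FL := framing_pullback tP FZ)).
apply: cohomologous_eq LN => a b g x bx ax.
  by congr (_ * _); apply/esym; [apply: EL; exact: rP|apply: FN; exact: sP].
by apply/esym/ZP; exact: tP.
Qed.

Definition bundle_cocycle (E : bundle) : cocycle rho := sval (cid (has_cocycle_exists E)).

Lemma bundle_cocycleP E : has_cocycle E (bundle_cocycle E).
Proof. exact: proj2_sig (cid (has_cocycle_exists E)). Qed.

Lemma bundle_cocycle_equiv E F :
  elb_equiv E F <-> coc_equiv (bundle_cocycle E) (bundle_cocycle F).
Proof. exact: has_cocycle_equiv (bundle_cocycleP E) (bundle_cocycleP F). Qed.

Lemma bundle_cocycle_tensor E F Z : is_tensor E F Z <->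
  is_coc_product (bundle_cocycle E) (bundle_cocycle F) (bundle_cocycle Z).
Proof.
exact: has_cocycle_tensor (bundle_cocycleP E) (bundle_cocycleP F) (bundle_cocycleP Z).
Qed.

Lemma bundle_cocycle_surj L : exists E, coc_equiv (bundle_cocycle E) L.
Proof.
have [E EL] := has_cocycle_surj L; exists E.
apply/(has_cocycle_equiv (bundle_cocycleP E) EL).
exact/bundle_cocycle_equiv/coc_equiv_refl.
Qed.

End Classification.

Theorem proposition11 (R : realType) (k : lie_kind) (m n : nat)
    (G : lieGroup R k m) (M : complexManifold R n) (rho : action G M) :
  inhabited (picardGroup rho) /\ inhabited (H1Group rho) /\
  forall (P : picardGroup rho) (H : H1Group rho),
    exists f : {additive P -> H}, bijective f.
Proof.
have H1 := H1Group_exists rho.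
split; [|split=> //].
  exact: (classGroup_transfer (@bundle_cocycle_equiv _ _ _ _ G M rho)
    (@bundle_cocycle_tensor _ _ _ _ G M rho) (@bundle_cocycle_surj _ _ _ _ G M rho) H1).
move=> P H; exact: (classGroup_iso (@bundle_cocycle_equiv _ _ _ _ G M rho)
  (@bundle_cocycle_tensor _ _ _ _ G M rho) (@bundle_cocycle_surj _ _ _ _ G M rho) P H).
Qed.
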